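(* Let $\Lambda$ be a finite dimensional algebra over a field $K$, and let $T=T_\Lambda$ be the set of (isomorphism classes of) non-projective indecomposable direct summands of syzygies of simple $\Lambda$-modules, including all simple modules. If $T$ is a finite set, then $$\operatorname{Findim}\Lambda^{\mathrm{op}}\le \operatorname{sub\text{-}ddell}\Lambda\le\operatorname{dell}\Lambda\le \phi_T\dim\Lambda\le\phi\dim\Lambda$$ and $$\operatorname{Findim}\Lambda^{\mathrm{op}}\le \operatorname{ddell}\Lambda\le\operatorname{dell}\Lambda\le \phi_T\dim\Lambda\le\phi\dim\Lambda .$$ In particular, since $\phi_T\dim\Lambda$ is finite, the finitistic dimension conjecture holds for $\Lambda^{\mathrm{op}}$ (i.e. $\operatorname{findim}\Lambda^{\mathrm{op}}<\infty$).
   Context: Modules are right $\Lambda$-modules; left $\Lambda$-modules are $\Lambda^{\mathrm{op}}$-modules. $\mathrm{Mod}\,\Lambda$ (resp. $\mathrm{mod}\,\Lambda$) is the category of all (resp. finitely generated) right $\Lambda$-modules. $\mathbb N$ is the set of nonnegative integers; the infimum of the empty set is $+\infty$. $\Omega M$ is the kernel of a projective cover $P_M\to M$, $\Omega^0M=M$, $\Omega^{n+1}M=\Omega(\Omega^nM)$; the syzygies of $M$ are the modules $\Omega^nM$. $\operatorname{Findim}$ (resp. $\operatorname{findim}$) of an algebra is the supremum of the projective dimensions of all (resp. all finitely generated) modules of finite projective dimension. ''$A$ is a direct summand of $B$ up to projective summands'' means that $A$ is isomorphic to a direct summand of $B\oplus P$ for some projective $P$. For an integer $k\ge0$, $k\text{-}\operatorname{dell}M$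 is the infimum of all $n\in\mathbb N$ such that $\Omega^nM$ is a direct summand of $\Omega^{n+k}N$ up to projective summands for some $N\in\mathrm{mod}\,\Lambda$; $\operatorname{dell}M=1\text{-}\operatorname{dell}M$. $\operatorname{sub\text{-}ddell}M=\inf\{\operatorname{dell}N\mid N\in\mathrm{mod}\,\Lambda,\ M\text{ embeds in }N\}$. $\operatorname{ddell}M$ is the infimum of all $m\in\mathbb N$ for which there exist $0\le n\le m$ and an exact sequence $0\to C_n\to\cdots\to C_0\to M\to0$ in $\mathrm{mod}\,\Lambda$ with $(i+1)\text{-}\operatorname{dell}C_i\le m-i$ for $i=0,\dots,n$. For each of $\operatorname{dell},\operatorname{sub\text{-}ddell},\operatorname{ddell}$, the value on $\Lambda$ is the supremum of the values on the simple $\Lambda$-modules. Let $K_0$ be the free abelian group generated by symbols $[M]$, $M\in\mathrm{mod}\,\Lambda$ (up to isomorphism), modulo the subgroup generated by $[P]$ for $P$ projective and $[M]-[N]-[N']$ whenever $M\cong N\oplus N'$. Let $L:K_0\to K_0$ be the endomorphism $[M]\mapsto[\Omega M]$. For a module $M$ (or a finite set $T$ of modules), $\langle\mathrm{add}\,M\rangle$ (resp. $\langle\mathrm{add}\,T\rangle$) is the subgroup of $K_0$ generated by the classes of all direct summands of finite direct sums of copies of $M$ (resp. of members of $T$). Define $$\phi(M)=\inf\{n\mid L^m\langle\mathrm{add}\,M\rangle\cong L^{m+1}\langle\mathrm{add}\,M\rangle\ \ \forall m\ge n\},\qquad \phi\dim\Lambda=\sup\{\phi(M)\mid M\in\mathrm{mod}\,\Lambda\},$$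 $$\phi_T\dim\Lambda=\inf\{n\mid L^m\langle\mathrm{add}\,T\rangle\cong L^{m+1}\langle\mathrm{add}\,T\rangle\ \ \forall m\ge n\},$$ where $\cong$ is isomorphism of abelian groups. *)

(* Defs.v *)
From HB Require Import structures.
From mathcomp Require Import all_boot all_order all_algebra all_field.
From mathcomp Require Import boolp.
Set Implicit Arguments.
Unset Strict Implicit.
Unset Printing Implicit Defensive.
Import GRing.Theory.
Local Open Scope ring_scope.

(** ** Extended natural numbers *)

Inductive enat : Type := Fin of nat | Infty.

Definition ele (x y : enat) : Prop :=
  match x, y with
  | _, Infty => True
  | Infty, Fin _ => False
  | Fin m, Fin n => (m <= n)%N
  end.

Declare Scope enat_scope.
Delimit Scope enat_scope with enat.
Notation "x <= y" := (ele x y) : enat_scope.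

Definition is_einf (S : enat -> Prop) (x : enat) : Prop :=
  (forall y, S y -> ele x y) /\
  (forall z, (forall y, S y -> ele z y) -> ele z x).

Lemma einf_exists (S : enat -> Prop) : exists x, is_einf S x.
Proof.
have [[n0 Sn0]|noS] := pselect (exists n, S (Fin n)).
  have exP : exists n, `[< S (Fin n) >] by exists n0; apply/asboolP.
  case: (ex_minnP exP) => m /asboolP Sm minm.
  exists (Fin m); split; last by move=> z; apply.
  by case=> [n Sn|] //=; apply/minm/asboolP.
exists Infty; split; last by case.
by case=> // n Sn; case: noS; exists n.
Qed.

Definition einf (S : enat -> Prop) : enat := projT1 (cid (einf_exists S)).

Lemma einfP (S : enat -> Prop) : is_einf S (einf S).
Proof. exact: projT2 (cid (einf_exists S)). Qed.

Definition esup (S : enat -> Prop) : enat :=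
  einf (fun z => forall y, S y -> ele y z).

Lemma esupP (S : enat -> Prop) :
  (forall y, S y -> ele y (esup S)) /\
  (forall z, (forall y, S y -> ele y z) -> ele (esup S) z).
Proof.
have [lb glb] := einfP (fun z => forall y, S y -> ele y z).
by split=> [y Sy|z zub]; [apply: glb => z; apply | apply: lb].
Qed.

Definition ninf (P : nat -> Prop) : enat :=
  einf (fun x => exists2 n, P n & x = Fin n).

(** ** Modules over a ring

    Everything in this part is stated for [lmodType R], i.e. left [R]-modules.
    Right modules over an algebra [A] are obtained with [R := A^c], the
    converse ring of [A]. *)

Section Modules.
Variable R : nzRingType.
Implicit Types M N X Y P : lmodType R.

Definition surj (A B : Type) (f : A -> B) : Prop := forall y, exists x, f x = y.

Definition zero_module M : Prop := forall x : M, x = 0.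

Definition isomorphic M N : Prop :=
  exists f : {linear M -> N}, injective f /\ surj f.

Definition embeds M N : Prop := exists f : {linear M -> N}, injective f.

Definition exact_at M N X (f : M -> N) (g : N -> X) : Prop :=
  forall y : N, g y = 0 <-> exists x, f x = y.

Definition dsummand M N : Prop :=
  exists M' : lmodType R, isomorphic N (M * M')%type.

Definition projective P : Prop :=
  forall (M N : lmodType R) (g : {linear M -> N}) (f : {linear P -> N}),
    surj g -> exists h : {linear P -> M}, forall x, g (h x) = f x.

Definition dsummand_upto_proj M N : Prop :=
  exists P : lmodType R, projective P /\ dsummand M (N * P)%type.

Definition submodule M (S : M -> Prop) : Prop :=
  S 0 /\ forall (a : R) x y, S x -> S y -> S (a *: x + y).

Definition simple M : Prop :=
  ~ zero_module M /\
  forall S : M -> Prop, submodule S ->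
    (forall x, S x -> x = 0) \/ (forall x, S x).

Definition indecomposable M : Prop :=
  ~ zero_module M /\
  forall A B : lmodType R, isomorphic M (A * B)%type ->
    zero_module A \/ zero_module B.

Definition finitely_generated M : Prop :=
  exists (n : nat) (g : 'I_n -> M),
    forall x, exists c : 'I_n -> R, x = \sum_(i < n) c i *: g i.

Definition superfluous M (S : M -> Prop) : Prop :=
  forall U : M -> Prop, submodule U ->
    (forall x, exists u s, U u /\ S s /\ x = u + s) -> forall x, U x.

Definition projective_cover P M (p : {linear P -> M}) : Prop :=
  [/\ projective P, surj p & superfluous (fun x => p x = 0)].

Definition is_syzygy X M : Prop :=
  exists (P : lmodType R) (p : {linear P -> M}) (i : {linear X -> P}),
    [/\ projective_cover p, injective i & exact_at i p].

(* The exact sequence 0 -> C_n -> ... -> C_0 -> M -> 0, continued by zero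
   modules to the left of C_n. *)
Definition left_resolution (n : nat) (C : nat -> lmodType R) M : Prop :=
  exists (e : {linear C 0%N -> M}) (d : forall i, {linear C i.+1 -> C i}),
    [/\ surj e,
        exact_at (d 0%N) e,
        forall i, exact_at (d i.+1) (d i)
      & forall i, (n < i)%N -> zero_module (C i)].

Definition pd M : enat :=
  ninf (fun n => exists C : nat -> lmodType R,
    left_resolution n C M /\ forall i, (i <= n)%N -> projective (C i)).

Definition big_findim : enat :=
  esup (fun x => exists M : lmodType R, pd M <> Infty /\ x = pd M).

Definition little_findim : enat :=
  esup (fun x => exists M : lmodType R,
    [/\ finitely_generated M, pd M <> Infty & x = pd M]).

(** ** Finitely generated modules and delooping levels *)

Record fgmod : Type := FGMod {
  fg_sort :> lmodType R;
  fg_gen : finitely_generated fg_sort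
}.

(* A chosen kernel of a projective cover of M, which is unique up to
   isomorphism. Over a finite dimensional algebra it always exists in fgmod, so
   the default value M is never taken. *)
Definition Omega (M : fgmod) : fgmod :=
  if pselect (exists X : fgmod, is_syzygy X M) is left ex
  then projT1 (cid ex) else M.

Definition Omegan (n : nat) (M : fgmod) : fgmod := iter n Omega M.

Definition kdell (k : nat) (M : fgmod) : enat :=
  ninf (fun n => exists N : fgmod,
    dsummand_upto_proj (Omegan n M) (Omegan (n + k) N)).

Definition dell (M : fgmod) : enat := kdell 1 M.

Definition sub_ddell (M : fgmod) : enat :=
  einf (fun x => exists N : fgmod, embeds M N /\ x = dell N).

Definition ddell (M : fgmod) : enat :=
  ninf (fun m => exists (n : nat) (C : nat -> fgmod),
    [/\ (n <= m)%N,
        left_resolution n C M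
      & forall i, (i <= n)%N -> ele (kdell i.+1 (C i)) (Fin (m - i))]).

Definition sup_simple (f : fgmod -> enat) : enat :=
  esup (fun x => exists S : fgmod, simple S /\ x = f S).

(** ** The group K_0 and the phi-dimensions

    K_0 is given by generators and relations: its elements are represented by
    the terms of type [K0], and its equality is [K0eq], the congruence generated
    by the abelian group laws and the defining relations. *)

Inductive K0 : Type :=
| K0class of fgmod
| K0zero
| K0add of K0 & K0
| K0opp of K0.

Inductive K0eq : K0 -> K0 -> Prop :=
| K0eq_refl x : K0eq x x
| K0eq_sym x y : K0eq x y -> K0eq y x
| K0eq_trans x y z : K0eq x y -> K0eq y z -> K0eq x z
| K0eq_add x x' y y' : K0eq x x' -> K0eq y y' -> K0eq (K0add x y) (K0add x' y')
| K0eq_opp x x' : K0eq x x' -> K0eq (K0opp x) (K0opp x')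
| K0eq_addA x y z : K0eq (K0add x (K0add y z)) (K0add (K0add x y) z)
| K0eq_addC x y : K0eq (K0add x y) (K0add y x)
| K0eq_add0 x : K0eq (K0add K0zero x) x
| K0eq_addN x : K0eq (K0add (K0opp x) x) K0zero
| K0eq_iso (M N : fgmod) : isomorphic M N -> K0eq (K0class M) (K0class N)
| K0eq_proj (P : fgmod) : projective P -> K0eq (K0class P) K0zero
| K0eq_dsum (M N N' : fgmod) : isomorphic M (N * N')%type ->
    K0eq (K0class M) (K0add (K0class N) (K0class N')).

Fixpoint K0L (x : K0) : K0 :=
  match x with
  | K0class M => K0class (Omega M)
  | K0zero => K0zero
  | K0add x y => K0add (K0L x) (K0L y)
  | K0opp x => K0opp (K0L x)
  end.

Inductive K0span (G : fgmod -> Prop) : K0 -> Prop :=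
| K0span_class (M : fgmod) : G M -> K0span G (K0class M)
| K0span_zero : K0span G K0zero
| K0span_add x y : K0span G x -> K0span G y -> K0span G (K0add x y)
| K0span_opp x : K0span G x -> K0span G (K0opp x)
| K0span_eq x y : K0eq x y -> K0span G x -> K0span G y.

Definition K0Limg (m : nat) (A : K0 -> Prop) : K0 -> Prop :=
  fun y => exists x, A x /\ K0eq (iter m K0L x) y.

(* Isomorphism of abelian groups between two subgroups of K_0. *)
Definition K0subgroup_iso (A B : K0 -> Prop) : Prop :=
  exists f : K0 -> K0,
    [/\ forall x, A x -> B (f x),
        forall x y, A x -> A y -> K0eq (f (K0add x y)) (K0add (f x) (f y)),
        forall x y, A x -> A y -> (K0eq (f x) (f y) <-> K0eq x y)
      & forall z, B z -> exists x, A x /\ K0eq (f x) z].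

Inductive finite_dsum (T : fgmod -> Prop) : lmodType R -> Prop :=
| finite_dsum0 (Z : lmodType R) : zero_module Z -> finite_dsum T Z
| finite_dsumS (X : fgmod) (Y : lmodType R) :
    T X -> finite_dsum T Y -> finite_dsum T (X * Y)%type.

Definition add_closure (T : fgmod -> Prop) (X : fgmod) : Prop :=
  exists Y : lmodType R, finite_dsum T Y /\ dsummand X Y.

Definition phi_set (T : fgmod -> Prop) : enat :=
  ninf (fun n => forall m, (n <= m)%N ->
    K0subgroup_iso (K0Limg m (K0span (add_closure T)))
                   (K0Limg m.+1 (K0span (add_closure T)))).

Definition phi (M : fgmod) : enat := phi_set (fun X : fgmod => X = M).

Definition sup_phi : enat := esup (fun x => exists M : fgmod, x = phi M).

Definition simple_syzygy_summand (X : fgmod) : Prop :=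
  simple X \/
  [/\ ~ projective X, indecomposable X
    & exists (S : fgmod) (n : nat), simple S /\ dsummand X (Omegan n S)].

Definition finite_up_to_iso (T : fgmod -> Prop) : Prop :=
  exists (n : nat) (r : 'I_n -> fgmod),
    forall X : fgmod, T X -> exists i, isomorphic X (r i).

End Modules.

(** ** Invariants of a finite dimensional algebra

    Right A-modules are [lmodType A^c]; right modules over the opposite
    algebra, i.e. left A-modules, are [lmodType A]. *)

Section Algebra.
Variables (K : fieldType) (A : falgType K).

Definition Findim_op : enat := big_findim A.
Definition findim_op : enat := little_findim A.
Definition dell_alg : enat := sup_simple (@dell A^c).
Definition sub_ddell_alg : enat := sup_simple (@sub_ddell A^c).
Definition ddell_alg : enat := sup_simple (@ddell A^c).
Definition phidim : enat := sup_phi A^c.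
Definition T_alg : fgmod A^c -> Prop := @simple_syzygy_summand A^c.
Definition phiTdim : enat := phi_set T_alg.

End Algebra.

(* Main.v *)
From HB Require Import structures.
Require Import Defs.
From mathcomp Require Import all_boot all_order all_algebra all_field.
From mathcomp Require Import ssrAC boolp classical_sets zify.
Set Implicit Arguments.
Unset Strict Implicit.
Unset Printing Implicit Defensive.
Import GRing.Theory.
Local Open Scope ring_scope.

(* Let X be a left module of projective dimension d. If Tor_d(S, X) = 0 for all
   simple S, then for the last map F_d -> F_(d-1) of a projective
   resolution the radical of F_(d-1) meets F_d in the radical of F_d; as A modulo
   its radical is semisimple and the radical is nilpotent, this map splits,
   contradicting the choice of d. Dimension shifting along a delooping of S, of a
   module containing S, or of the terms of a resolution of S embeds Tor_d(S, X)
   into some Tor_(d+1)(N, X) = 0 as soon as d exceeds the (sub-derived, derived)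
   delooping level of S. This bounds Findim. Tor is handled through its K-dual,
   i.e. through balanced forms with values in K.

   If T is finite, <add T> is a finitely generated abelian group stable under L,
   because exchange of summands shows that it is generated by T. It is
   noetherian, so the kernels of the powers of L stabilise and phi_T is finite.
   An abstract isomorphism of H = L^n<add T> with its subgroup L^(n+1)<add T> is
   an injective endomorphism of H, so every element of H has a nonzero multiple in
   the image: k[Omega^n S] = [Omega^(n+1) N1] - [Omega^(n+1) N2]. Finitely
   generated modules cancel from direct sums, so Omega^n S is stably a summand
   of Omega^(n+1) N1, whence dell S <= n. *)

(** * Constructions on modules *)

Section LinearMaps.
Variable R : nzRingType.
Implicit Types M N X Y P : lmodType R.

Definition linmap M N (f : M -> N) (lf : linear f) : {linear M -> N} :=
  HB.pack f (GRing.isLinear.Build R M N *:%R f lf).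

Lemma linear_id M : linear (@idfun M). Proof. by []. Qed.

Lemma linear_compose M N X (g : {linear N -> X}) (f : {linear M -> N}) :
  linear (g \o f).
Proof. by move=> a x y /=; rewrite !linearP. Qed.

Lemma linear_zero M N : linear (fun _ : M => 0 : N).
Proof. by move=> a x y; rewrite scaler0 addr0. Qed.

Lemma linear_add M N (f g : {linear M -> N}) : linear (fun x => f x + g x).
Proof. by move=> a x y; rewrite !linearP scalerDr addrACA. Qed.

Lemma linear_sub M N (f g : {linear M -> N}) : linear (fun x => f x - g x).
Proof. by move=> a x y; rewrite (linearP f) (linearP g) scalerBr opprD addrACA. Qed.

Lemma linear_pair M N X (f : {linear M -> N}) (g : {linear M -> X}) :
  linear (fun x => (f x, g x)).
Proof. by move=> a x y; rewrite !linearP. Qed.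

Lemma linear_fst M N : linear (@fst M N). Proof. by []. Qed.
Lemma linear_snd M N : linear (@snd M N). Proof. by []. Qed.

Definition lid M := linmap (linear_id (M := M)).
Definition lcomp M N X (g : {linear N -> X}) (f : {linear M -> N}) :=
  linmap (linear_compose g f).
Definition lzero M N := linmap (@linear_zero M N).
Definition ladd M N (f g : {linear M -> N}) := linmap (linear_add f g).
Definition lsub M N (f g : {linear M -> N}) := linmap (linear_sub f g).
Definition lpair M N X (f : {linear M -> N}) (g : {linear M -> X}) :=
  linmap (linear_pair f g).
Definition lfst M N := linmap (@linear_fst M N).
Definition lsnd M N := linmap (@linear_snd M N).
Definition linl M N : {linear M -> (M * N)%type} := lpair (lid M) (lzero M N).
Definition linr M N : {linear N -> (M * N)%type} := lpair (lzero N M) (lid N).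

Lemma linear_scale_elt M (m : M) : linear (fun a : R^o => a *: m).
Proof. by move=> a x y; rewrite scalerDl scalerA. Qed.

Definition lelt M (m : M) : {linear R^o -> M} := linmap (linear_scale_elt m).

Lemma linear_inverse M N (f : {linear M -> N}) (g : N -> M) :
  injective f -> cancel g f -> linear g.
Proof. by move=> fi gK a x y; apply: fi; rewrite linearP !gK. Qed.

Lemma inverse_map M N (f : {linear M -> N}) : injective f -> surj f ->
  exists g : {linear N -> M}, cancel f g /\ cancel g f.
Proof.
move=> fi fs; pose g y := projT1 (cid (fs y)).
have gK : cancel g f by move=> y; exact: projT2 (cid (fs y)).
exists (linmap (linear_inverse fi gK)); split=> [x|y]; last exact: gK.
exact: fi _ _ (gK (f x)).
Qed.

Lemma injective_ker0 M N (f : {linear M -> N}) :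
  (forall x, f x = 0 -> x = 0) -> injective f.
Proof.
move=> f0 x y /eqP; rewrite -subr_eq0 -linearB => /eqP/f0/eqP.
by rewrite subr_eq0 => /eqP.
Qed.

Fixpoint liter M (f : {linear M -> M}) n : {linear M -> M} :=
  if n is n'.+1 then lcomp f (liter f n') else lid M.

Lemma literE M (f : {linear M -> M}) n x : liter f n x = iter n f x.
Proof. by elim: n x => //= n IH x; rewrite IH. Qed.

End LinearMaps.

Section Submodules.
Variables (R : nzRingType) (M : lmodType R) (S : M -> Prop).
Hypothesis hS : submodule S.

Lemma submodD x y : S x -> S y -> S (x + y).
Proof. by move=> Sx Sy; have := hS.2 1 x y Sx Sy; rewrite scale1r. Qed.

Lemma submodZ a x : S x -> S (a *: x).
Proof. by move=> Sx; have := hS.2 a x 0 Sx hS.1; rewrite addr0. Qed.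

Lemma submodN x : S x -> S (- x).
Proof. by move=> Sx; rewrite -scaleN1r; apply: submodZ. Qed.

Lemma submodB x y : S x -> S y -> S (x - y).
Proof. by move=> Sx /submodN; apply: submodD. Qed.

End Submodules.

Section SubmoduleType.
Variables (R : nzRingType) (M : lmodType R) (S : M -> Prop).

Definition subm (hS : submodule S) := {x : M | `[< S x >]}.

Variable hS : submodule S.
Notation T := (subm hS).

HB.instance Definition _ := SubType.copy T {x : M | `[< S x >]}.
HB.instance Definition _ := [Choice of T by <:].

Lemma subm_prop (x : T) : S (val x). Proof. exact/asboolP/(valP x). Qed.

Definition mksubm x (Sx : S x) : T := Sub x (introT (asboolP _) Sx).

Definition subm_zero : T := mksubm hS.1.
Definition subm_opp (x : T) : T := mksubm (submodN hS (subm_prop x)).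
Definition subm_add (x y : T) : T := mksubm (submodD hS (subm_prop x) (subm_prop y)).
Definition subm_scale a (x : T) : T := mksubm (submodZ hS a (subm_prop x)).

Lemma subm_addA : associative subm_add.
Proof. by move=> x y z; apply: val_inj; rewrite /= addrA. Qed.
Lemma subm_addC : commutative subm_add.
Proof. by move=> x y; apply: val_inj; rewrite /= addrC. Qed.
Lemma subm_add0 : left_id subm_zero subm_add.
Proof. by move=> x; apply: val_inj; rewrite /= add0r. Qed.
Lemma subm_addN : left_inverse subm_zero subm_opp subm_add.
Proof. by move=> x; apply: val_inj; rewrite /= addNr. Qed.

HB.instance Definition _ :=
  GRing.isZmodule.Build T subm_addA subm_addC subm_add0 subm_addN.

Lemma subm_scaleA a b x : subm_scale a (subm_scale b x) = subm_scale (a * b) x.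
Proof. by apply: val_inj; rewrite /= scalerA. Qed.
Lemma subm_scale1 : left_id 1 subm_scale.
Proof. by move=> x; apply: val_inj; rewrite /= scale1r. Qed.
Lemma subm_scaleDr : right_distributive subm_scale +%R.
Proof. by move=> a x y; apply: val_inj; rewrite /= scalerDr. Qed.
Lemma subm_scaleDl x : {morph subm_scale^~ x : a b / a + b}.
Proof. by move=> a b; apply: val_inj; rewrite /= scalerDl. Qed.

HB.instance Definition _ := GRing.Zmodule_isLmodule.Build R T
  subm_scaleA subm_scale1 subm_scaleDr subm_scaleDl.

Lemma linear_subm_val : linear (fun x : T => val x). Proof. by []. Qed.

Definition submval : {linear T -> M} := linmap linear_subm_val.

Lemma submval_inj : injective submval. Proof. exact: val_inj. Qed.

Lemma linear_to_subm (N : lmodType R) (f : {linear N -> M})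
  (fS : forall x, S (f x)) : linear (fun x => mksubm (fS x)).
Proof. by move=> a x y; apply: val_inj; rewrite /= linearP. Qed.

Definition tosubm (N : lmodType R) (f : {linear N -> M})
  (fS : forall x, S (f x)) : {linear N -> T} := linmap (linear_to_subm fS).

End SubmoduleType.

Section QuotientType.
Variables (R : nzRingType) (M : lmodType R) (S : M -> Prop).

(* The quotient by [S] is carried by a set of representatives of the cosets. *)
Definition coset_repr (x : M) : M := choose (fun y => `[< S (x - y) >]) x.

Definition quom (hS : submodule S) := {x : M | coset_repr x == x}.

Variable hS : submodule S.
Notation T := (quom hS).

HB.instance Definition _ := SubType.copy T {x : M | coset_repr x == x}.
HB.instance Definition _ := [Choice of T by <:].

Lemma coset_reprP x : S (x - coset_repr x).
Proof.
by apply/asboolP; apply: (@chooseP _ (fun y => `[< S (x - y) >])); apply/asboolP;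
   rewrite subrr; exact: hS.1.
Qed.

Lemma coset_repr_eq x y : S (x - y) -> coset_repr x = coset_repr y.
Proof.
move=> Sxy; rewrite /coset_repr.
have e : (fun z => `[< S (x - z) >]) =1 (fun z => `[< S (y - z) >]).
  move=> z; apply/asboolP/asboolP => [Sz|Sz].
    by have := submodB hS Sz Sxy; rewrite opprB addrAC addrCA subrr addr0 addrC.
  by have := submodD hS Sxy Sz; rewrite addrA subrK.
rewrite (eq_choose e); apply: choose_id; apply/asboolP.
  by rewrite -opprB; exact: submodN.
by rewrite subrr; exact: hS.1.
Qed.

Lemma coset_repr_idem x : coset_repr (coset_repr x) == coset_repr x.
Proof.
apply/eqP; apply: coset_repr_eq; rewrite -opprB.
exact: submodN (coset_reprP x).
Qed.

Definition toquo_fun x : T := exist _ (coset_repr x) (coset_repr_idem x).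

Lemma toquo_eq x y : toquo_fun x = toquo_fun y <-> S (x - y).
Proof.
split=> [/(congr1 val) /= e|/coset_repr_eq e]; last exact: val_inj.
have := submodB hS (coset_reprP x) (coset_reprP y).
by rewrite e opprB addrA subrK.
Qed.

Lemma toquo_val (x : T) : toquo_fun (val x) = x.
Proof. by apply: val_inj => /=; apply/eqP; exact: (valP x). Qed.

Lemma toquo_repr x : S (val (toquo_fun x) - x).
Proof. by apply/toquo_eq; exact: toquo_val. Qed.

Definition quom_zero : T := toquo_fun 0.
Definition quom_opp (x : T) : T := toquo_fun (- val x).
Definition quom_add (x y : T) : T := toquo_fun (val x + val y).
Definition quom_scale a (x : T) : T := toquo_fun (a *: val x).

Lemma quom_addE x y : quom_add (toquo_fun x) (toquo_fun y) = toquo_fun (x + y).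
Proof.
by apply/toquo_eq; rewrite opprD addrACA; apply: submodD => //; exact: toquo_repr.
Qed.

Lemma quom_oppE x : quom_opp (toquo_fun x) = toquo_fun (- x).
Proof.
by apply/toquo_eq; rewrite -opprD; apply: submodN => //; exact: toquo_repr.
Qed.

Lemma quom_scaleE a x : quom_scale a (toquo_fun x) = toquo_fun (a *: x).
Proof.
by apply/toquo_eq; rewrite -scalerBr; apply: submodZ => //; exact: toquo_repr.
Qed.

Lemma quom_addA : associative quom_add.
Proof.
move=> x y z; rewrite -(toquo_val x) -(toquo_val y) -(toquo_val z).
by rewrite !quom_addE addrA.
Qed.
Lemma quom_addC : commutative quom_add.
Proof. by move=> x y; rewrite /quom_add addrC. Qed.
Lemma quom_add0 : left_id quom_zero quom_add.
Proof. by move=> x; rewrite -(toquo_val x) quom_addE add0r. Qed.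
Lemma quom_addN : left_inverse quom_zero quom_opp quom_add.
Proof. by move=> x; rewrite -(toquo_val x) quom_oppE quom_addE addNr. Qed.

HB.instance Definition _ :=
  GRing.isZmodule.Build T quom_addA quom_addC quom_add0 quom_addN.

Lemma toquo_funD x y : toquo_fun (x + y) = toquo_fun x + toquo_fun y.
Proof. by rewrite -quom_addE. Qed.

Lemma quom_scaleA a b x : quom_scale a (quom_scale b x) = quom_scale (a * b) x.
Proof. by rewrite -(toquo_val x) !quom_scaleE scalerA. Qed.
Lemma quom_scale1 : left_id 1 quom_scale.
Proof. by move=> x; rewrite -(toquo_val x) quom_scaleE scale1r. Qed.
Lemma quom_scaleDr : right_distributive quom_scale +%R.
Proof.
move=> a x y; rewrite -(toquo_val x) -(toquo_val y) -toquo_funD !quom_scaleE.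
by rewrite -toquo_funD scalerDr.
Qed.
Lemma quom_scaleDl x : {morph quom_scale^~ x : a b / a + b}.
Proof.
by move=> a b; rewrite -(toquo_val x) !quom_scaleE -toquo_funD scalerDl.
Qed.

HB.instance Definition _ := GRing.Zmodule_isLmodule.Build R T
  quom_scaleA quom_scale1 quom_scaleDr quom_scaleDl.

Lemma linear_toquo : linear toquo_fun.
Proof. by move=> a x y; rewrite toquo_funD -quom_scaleE. Qed.

Definition toquo : {linear M -> T} := linmap linear_toquo.

Lemma toquo_surj : surj toquo.
Proof. by move=> y; exists (val y); exact: toquo_val. Qed.

Lemma toquo_ker x : toquo x = 0 <-> S x.
Proof. by rewrite -[0](linear0 toquo) -[X in S X]subr0; exact: toquo_eq. Qed.

End QuotientType.

Section SubmoduleLattice.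
Variable R : nzRingType.
Implicit Types M N : lmodType R.

Lemma submodule_all M : submodule (fun _ : M => True).
Proof. by []. Qed.

Lemma submodule_zero M : submodule (fun x : M => x = 0).
Proof. by split=> // a x y -> ->; rewrite scaler0 addr0. Qed.

Lemma submodule_ker M N (f : {linear M -> N}) : submodule (fun x => f x = 0).
Proof.
by split=> [|a x y fx fy]; rewrite ?linear0 ?linearP // fx fy scaler0 addr0.
Qed.

Lemma submodule_img M N (f : {linear M -> N}) (S : M -> Prop) : submodule S ->
  submodule (fun y => exists x, S x /\ f x = y).
Proof.
move=> hS; split; first by exists 0; rewrite linear0; split=> //; exact: hS.1.
move=> a y z [x [Sx <-]] [x' [Sx' <-]]; exists (a *: x + x'); rewrite linearP.
by split=> //; apply: hS.2.
Qed.

Lemma submodule_range M N (f : {linear M -> N}) :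
  submodule (fun y => exists x, f x = y).
Proof.
split; first by exists 0; rewrite linear0.
by move=> a y z [x <-] [x' <-]; exists (a *: x + x'); rewrite linearP.
Qed.

Lemma submodule_preim M N (f : {linear M -> N}) (S : N -> Prop) : submodule S ->
  submodule (fun x => S (f x)).
Proof.
by move=> hS; split=> [|a x y Sx Sy]; rewrite ?linear0 ?linearP;
  [exact: hS.1 | exact: hS.2].
Qed.

Lemma submodule_cap M (S T : M -> Prop) : submodule S -> submodule T ->
  submodule (fun x => S x /\ T x).
Proof.
move=> hS hT; split=> [|a x y [Sx Tx] [Sy Ty]].
  by split; [exact: hS.1 | exact: hT.1].
by split; [exact: hS.2 | exact: hT.2].
Qed.

Lemma submodule_sum M (S T : M -> Prop) : submodule S -> submodule T ->
  submodule (fun x => exists u v, [/\ S u, T v & x = u + v]).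
Proof.
move=> hS hT; split=> [|a x y [u [v [Su Tv ->]]] [u' [v' [Su' Tv' ->]]]].
  by exists 0, 0; split; rewrite ?addr0 //; [exact: hS.1 | exact: hT.1].
exists (a *: u + u'), (a *: v + v'); split; [exact: hS.2 | exact: hT.2 |].
by rewrite scalerDr addrACA.
Qed.

Definition kerm M N (f : {linear M -> N}) : lmodType R := subm (submodule_ker f).
Definition imgm M N (f : {linear M -> N}) : lmodType R := subm (submodule_range f).

Definition zmod : lmodType R := subm (submodule_zero R^o).

Lemma zmod_zero : zero_module zmod.
Proof. by move=> x; apply: val_inj; exact: (subm_prop x). Qed.

End SubmoduleLattice.

(** * Isomorphisms, direct summands and projective modules *)

Section Summands.
Variable R : nzRingType.
Implicit Types M N X Y Z P Q : lmodType R.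

Lemma isomorphicI M N (f : {linear M -> N}) (g : N -> M) :
  cancel f g -> cancel g f -> isomorphic M N.
Proof.
by move=> fK gK; exists f; split=> [|y]; [exact: can_inj fK | exists (g y)].
Qed.

Lemma isomorphicE M N : isomorphic M N ->
  exists (f : {linear M -> N}) (g : {linear N -> M}), cancel f g /\ cancel g f.
Proof. by case=> f [fi fs]; exists f; exact: inverse_map. Qed.

Lemma iso_refl M : isomorphic M M.
Proof. exact: (isomorphicI (f := lid M) (g := id)). Qed.

Lemma iso_sym M N : isomorphic M N -> isomorphic N M.
Proof.
by move=> /isomorphicE [f [g [fK gK]]]; apply: (isomorphicI (f := g) (g := f)).
Qed.

Lemma iso_trans N M X : isomorphic M N -> isomorphic N X -> isomorphic M X.
Proof.
move=> /isomorphicE [f [g [fK gK]]] /isomorphicE [h [k [hK kK]]].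
by apply: (isomorphicI (f := lcomp h f) (g := g \o k)) => x /=;
  rewrite ?hK ?gK ?fK ?kK.
Qed.

Lemma iso_prod M N M' N' : isomorphic M N -> isomorphic M' N' ->
  isomorphic (M * M')%type (N * N')%type.
Proof.
move=> /isomorphicE [f [g [fK gK]]] /isomorphicE [h [k [hK kK]]].
apply: (isomorphicI (f := lpair (lcomp f (lfst M M')) (lcomp h (lsnd M M')))
         (g := fun z => (g z.1, k z.2))) => -[x y] /=;
by rewrite ?fK ?gK ?hK ?kK.
Qed.

Lemma iso_prodC M N : isomorphic (M * N)%type (N * M)%type.
Proof.
by apply: (isomorphicI (f := lpair (lsnd M N) (lfst M N))
         (g := fun z => (z.2, z.1))) => -[x y].
Qed.

Lemma iso_prodA M N X : isomorphic (M * (N * X))%type (M * N * X)%type.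
Proof.
pose p1 := lfst M (N * X)%type; pose p2 := lsnd M (N * X)%type.
by apply: (isomorphicI (f := lpair (lpair p1 (lcomp (lfst N X) p2))
          (lcomp (lsnd N X) p2)) (g := fun z => (z.1.1, (z.1.2, z.2))))
   => [[x [y z]]|[[x y] z]].
Qed.

Lemma iso_prod0 Z M : zero_module Z -> isomorphic (Z * M)%type M.
Proof.
move=> Z0; apply: (isomorphicI (f := lsnd Z M) (g := fun x => (0, x))) => //.
by case=> z x /=; rewrite (Z0 z).
Qed.

Lemma iso_zero_module Z Z' : isomorphic Z Z' -> zero_module Z -> zero_module Z'.
Proof. by case=> f [_ fs] Z0 y; have [x <-] := fs y; rewrite (Z0 x) linear0. Qed.

Lemma retract_iso X Y (s : {linear X -> Y}) (r : {linear Y -> X}) :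
  cancel s r -> isomorphic Y (X * kerm r)%type.
Proof.
move=> sK; have rk y : r (lsub (lid Y) (lcomp s r) y) = 0.
  by rewrite /= linearB /= sK subrr.
apply: (isomorphicI (f := lpair r (tosubm (submodule_ker r) rk))
         (g := fun z => s z.1 + val z.2)) => [y|[x y]] /=.
  by rewrite addrCA subrr addr0.
have ry : r (val y) = 0 := subm_prop y.
have e : r (s x + val y) = x by rewrite linearD /= sK ry addr0.
by congr (_, _) => //; apply: val_inj => /=; rewrite e addrAC subrr add0r.
Qed.

Lemma dsummandP X Y : dsummand X Y <->
  exists (s : {linear X -> Y}) (r : {linear Y -> X}), cancel s r.
Proof.
split=> [[X' /isomorphicE [f [g [fK gK]]]]|[s [r sK]]]; last first.
  by exists (kerm r); exact: retract_iso sK.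
by exists (lcomp g (linl X X')), (lcomp (lfst X X') f) => x /=; rewrite gK.
Qed.

Lemma dsummand_refl X : dsummand X X.
Proof. by apply/dsummandP; exists (lid X), (lid X). Qed.

Lemma dsummand_trans Y X Z : dsummand X Y -> dsummand Y Z -> dsummand X Z.
Proof.
move=> /dsummandP [s [r sK]] /dsummandP [s' [r' sK']]; apply/dsummandP.
by exists (lcomp s' s), (lcomp r r') => x /=; rewrite sK' sK.
Qed.

Lemma dsummand_iso X Y : isomorphic X Y -> dsummand X Y.
Proof.
by move=> /isomorphicE [f [g [fK _]]]; apply/dsummandP; exists f, g.
Qed.

Lemma dsummand_prodl X Y : dsummand X (X * Y)%type.
Proof. by apply/dsummandP; exists (linl X Y), (lfst X Y). Qed.

Lemma dsummand_prodr X Y : dsummand Y (X * Y)%type.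
Proof. by apply/dsummandP; exists (linr X Y), (lsnd X Y). Qed.

Lemma dsummand_prod X Y X' Y' : dsummand X Y -> dsummand X' Y' ->
  dsummand (X * X')%type (Y * Y')%type.
Proof.
move=> /dsummandP [s [r sK]] /dsummandP [s' [r' sK']]; apply/dsummandP.
exists (lpair (lcomp s (lfst X X')) (lcomp s' (lsnd X X'))).
by exists (lpair (lcomp r (lfst Y Y')) (lcomp r' (lsnd Y Y'))) => -[x y] /=;
  rewrite sK sK'.
Qed.

Lemma projective_dsummand P Q : dsummand Q P -> projective P -> projective Q.
Proof.
move=> /dsummandP [s [r sK]] prP M N g f gs.
have [h hE] := prP M N g (lcomp f r) gs.
by exists (lcomp h s) => x /=; rewrite hE /= sK.
Qed.

Lemma projective_iso P Q : isomorphic P Q -> projective P -> projective Q.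
Proof. by move=> /iso_sym/dsummand_iso; exact: projective_dsummand. Qed.

Lemma projective_prod P Q : projective P -> projective Q ->
  projective (P * Q)%type.
Proof.
move=> prP prQ M N g f gs.
have [h hE] := prP M N g (lcomp f (linl P Q)) gs.
have [k kE] := prQ M N g (lcomp f (linr P Q)) gs.
exists (ladd (lcomp h (lfst P Q)) (lcomp k (lsnd P Q))) => -[x y] /=.
by rewrite linearD hE kE /= -linearD; congr (f (_, _)); rewrite ?addr0 ?add0r.
Qed.

Lemma projective_zero Z : zero_module Z -> projective Z.
Proof.
move=> Z0 M N g f gs; exists (lzero Z M) => x /=.
by rewrite (Z0 x) !linear0.
Qed.

Lemma projective_regular : projective (R^o : lmodType R).
Proof.
move=> M N g f gs; have [m gm] := gs (f 1).
exists (lelt m) => a /=; rewrite linearZ /= gm -linearZ /=.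
by congr (f _); exact: mulr1.
Qed.

Lemma projective_section M P (p : {linear M -> P}) : projective P -> surj p ->
  exists s : {linear P -> M}, cancel s p.
Proof. by move=> prP ps; have [s sE] := prP M P p (lid P) ps; exists s. Qed.

Lemma exact_kerm M N (f : {linear M -> N}) : exact_at (submval (submodule_ker f)) f.
Proof.
move=> y; split=> [fy|[x <-]]; last exact: (subm_prop x).
by exists (mksubm (submodule_ker f) fy).
Qed.

End Summands.

(** * Modules of finite length *)

Section Ranked.
Variable R : nzRingType.
Implicit Types M N X Y Z P Q : lmodType R.

(* A strictly monotone bounded function on submodules: a substitute for the
   length, or for the dimension over the ground field. *)
Definition ranked M n : Prop := exists rho : (M -> Prop) -> nat,
  (forall S, submodule S -> (rho S <= n)%N) /\
  (forall S S', submodule S -> submodule S' -> (forall x, S x -> S' x) ->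
     (rho S <= rho S')%N /\ ((rho S' <= rho S)%N -> forall x, S' x -> S x)).

Definition finlen M : Prop := exists n, ranked M n.

Lemma ranked_zero Z : zero_module Z -> ranked Z 0.
Proof.
move=> Z0; exists (fun=> 0%N); split=> // S S' hS hS' SS'; split=> // _ x _.
by rewrite (Z0 x); exact: hS.1.
Qed.

Lemma ranked_extension N M Q (i : {linear N -> M}) (p : {linear M -> Q}) a b :
  (forall x, p x = 0 -> exists y, i y = x) -> ranked N a -> ranked Q b ->
  ranked M (a + b).
Proof.
move=> ip [rN [bN sN]] [rQ [bQ sQ]].
pose im (S : M -> Prop) y := exists x, S x /\ p x = y.
exists (fun S => rN (fun x => S (i x)) + rQ (im S))%N.
split=> [S hS|S S' hS hS' SS'].
  by apply: leq_add; rewrite ?bN ?bQ //; [exact: submodule_preim|exact: submodule_img].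
have [le1 eq1] := sN _ _ (submodule_preim i hS) (submodule_preim i hS')
  (fun x => SS' (i x)).
have imS : forall y, im S y -> im S' y by move=> y [x [/SS' Sx e]]; exists x.
have [le2 eq2] : (rQ (im S) <= rQ (im S'))%N /\
    ((rQ (im S') <= rQ (im S))%N -> forall y, im S' y -> im S y).
  exact: sQ (submodule_img p hS) (submodule_img p hS') imS.
split; first exact: leq_add.
move=> le x S'x.
have [||y [Sy pyx]] := eq2 _ (p x).
- lia.
- by exists x.
have [|t tE] := ip (x - y); first by rewrite linearB /= pyx subrr.
have St : S (i t).
  apply: eq1; last by rewrite tE; apply: submodB => //; exact: SS'.
  lia.
by rewrite -(subrK y x) -tE; apply: submodD.
Qed.

Lemma ranked_injective N M (f : {linear N -> M}) n : injective f ->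
  ranked M n -> ranked N n.
Proof.
move=> fi [rho [b s]]; pose im (S : N -> Prop) y := exists x, S x /\ f x = y.
exists (fun S => rho (im S)); split=> [S hS|S S' hS hS' SS'].
  by apply: b; exact: submodule_img.
have imS : forall y, im S y -> im S' y by move=> y [x [/SS' Sx e]]; exists x.
have [le eq] := s _ _ (submodule_img f hS) (submodule_img f hS') imS.
split=> // /eq{}eq x S'x; have [|y [Sy /fi <-]] := eq (f x) => //.
by exists x.
Qed.

Lemma ranked_proper N M (f : {linear N -> M}) n : injective f -> ~ surj f ->
  ranked M n -> exists2 m, (m < n)%N & ranked N m.
Proof.
move=> fi fns [rho [b s]]; pose im (S : N -> Prop) y := exists x, S x /\ f x = y.
pose top := rho (fun=> True).
have lt S : submodule S -> (rho (im S) < top)%N.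
  move=> hS.
  have [|le eq] := s _ _ (submodule_img f hS) (@submodule_all _ M); first by [].
  rewrite ltn_neqAle le andbT; apply/eqP => e; apply: fns => y.
  have [||x [_ <-]] := eq _ y => //; last by exists x.
  by rewrite /top /im in e *; rewrite e.
have top_gt0 : (0 < top)%N by apply: leq_ltn_trans (lt _ (@submodule_all _ N)).
exists top.-1; first by rewrite prednK //; apply: b.
exists (fun S => rho (im S)); split=> [S hS|S S' hS hS' SS'].
  by rewrite -ltnS prednK //; apply: lt.
have imS : forall y, im S y -> im S' y by move=> y [x [/SS' Sx e]]; exists x.
have [le eq] := s _ _ (submodule_img f hS) (submodule_img f hS') imS.
split=> // /eq{}eq x S'x; have [|y [Sy /fi <-]] := eq (f x) => //.
by exists x.
Qed.

Lemma ranked_surjective M N (p : {linear M -> N}) n : surj p ->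
  ranked M n -> ranked N n.
Proof.
move=> ps [rho [b s]].
exists (fun S => rho (fun x => S (p x))); split=> [S hS|S S' hS hS' SS'].
  by apply: b; exact: submodule_preim.
have [le eq] := s _ _ (submodule_preim p hS) (submodule_preim p hS')
  (fun x => SS' (p x)).
by split=> // /eq{}eq y S'y; have [x xy] := ps y; rewrite -xy in S'y *; exact: eq.
Qed.

Lemma finlen_prod M N : finlen M -> finlen N -> finlen (M * N)%type.
Proof.
move=> [a ra] [b rb]; exists (a + b)%N.
apply: (ranked_extension (i := linl M N) (p := lsnd M N)) => // -[x y] /= ->.
by exists x.
Qed.

Lemma ranked_iso M N n : isomorphic M N -> ranked M n -> ranked N n.
Proof. by move=> [f [_ fs]] rn; exact: ranked_surjective rn. Qed.

Lemma ranked_ascending M n (S : nat -> M -> Prop) : ranked M n ->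
  (forall k, submodule (S k)) -> (forall k x, S k x -> S k.+1 x) ->
  exists k, forall x, S k.+1 x -> S k x.
Proof.
move=> [rho [b s]] hS inc; apply: contrapT => no.
suff lb k : (k <= rho (S k))%N by have := leq_trans (lb n.+1) (b _ (hS _)); rewrite ltnn.
elim: k => // k IH; have [le eq] := s _ _ (hS k) (hS k.+1) (inc k).
rewrite ltn_neqAle (leq_trans IH le) andbT; apply/eqP => e.
apply: no; exists k; apply: eq; by rewrite -e.
Qed.

Lemma ranked_descending M n (S : nat -> M -> Prop) : ranked M n ->
  (forall k, submodule (S k)) -> (forall k x, S k.+1 x -> S k x) ->
  exists k, forall x, S k x -> S k.+1 x.
Proof.
move=> [rho [b s]] hS dec; apply: contrapT => no.
suff lb k : (rho (S k) + k <= n)%N.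
  by have := leq_trans (leq_addl _ _) (lb n.+1); rewrite ltnn.
elim: k => [|k IH]; first by rewrite addn0; exact: b.
have [le eq] := s _ _ (hS k.+1) (hS k) (dec k).
rewrite addnS -addSn; apply: leq_trans IH; rewrite leq_add2r.
rewrite ltn_neqAle le andbT; apply/eqP => e.
by apply: no; exists k; apply: eq; rewrite e.
Qed.

Lemma finlen_inj_surj M (f : {linear M -> M}) : finlen M -> injective f -> surj f.
Proof.
move=> [n rn] fi y.
have [|k kP] := ranked_descending rn (fun k => submodule_range (liter f k)).
  by move=> k _ [x <-]; exists (f x); rewrite /= !literE -iterSr.
have [|z] := kP (liter f k y); first by exists y.
rewrite !literE iterSr => e; exists z; elim: k e {kP} => //= k IH /fi; exact: IH.
Qed.

Lemma finlen_surj_inj M (f : {linear M -> M}) : finlen M -> surj f -> injective f.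
Proof.
move=> [n rn] fs; apply: injective_ker0 => x fx.
have [|k kP] := ranked_ascending rn (fun k => submodule_ker (liter f k)).
  by move=> k y; rewrite /= => ->; rewrite linear0.
have its m y : exists z, iter m f z = y.
  elim: m y => [|m IH] y; first by exists y.
  by have [z <-] := fs y; have [w <-] := IH z; exists w.
have [z zx] := its k x.
have := kP z; rewrite !literE /= zx => /(_ fx); exact.
Qed.

(* Fitting's lemma, phrased with the retraction onto the stable image. *)
Lemma Fitting M (f : {linear M -> M}) : finlen M ->
  exists k, (0 < k)%N /\ let g := liter f k in
  exists r : {linear M -> imgm g}, cancel (submval (submodule_range g)) r /\
    forall x, r x = 0 -> g x = 0.
Proof.
move=> [n rn].
have [|k1 kP1] := ranked_descending rn (fun k => submodule_range (liter f k)).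
  by move=> k _ [x <-]; exists (f x); rewrite /= !literE -iterSr.
have [|k2 kP2] := ranked_ascending rn (fun k => submodule_ker (liter f k)).
  by move=> k y; rewrite /= => ->; rewrite linear0.
have im1 m y : (exists x, iter k1 f x = y) -> exists x, iter (k1 + m) f x = y.
  elim: m y => [|m IH] y; first by rewrite addn0.
  move=> [x <-]; have [|z zE] := kP1 (liter f k1 x); first by exists x.
  rewrite literE in zE; rewrite !literE /= in zE.
  have [|w wE] := IH (iter k1 f z); first by exists z.
  by exists w; rewrite addnS /= wE.
have ke1 m y : iter (k2 + m) f y = 0 -> iter k2 f y = 0.
  elim: m y => [|m IH] y; first by rewrite addn0.
  rewrite addnS iterSr => /IH; rewrite -iterSr => e.
  by have := kP2 y; rewrite !literE => /(_ e).
pose k := (k1 + k2).+1; exists k; split=> //= ; set g := lcomp _ _.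
have gE x : g x = iter k f x by rewrite /g /= literE.
pose h : {linear imgm g -> imgm g} :=
  tosubm (submodule_range g) (f := lcomp g (submval (submodule_range g)))
           (fun x => ex_intro _ (val x) erefl).
have hi : injective h.
  apply: injective_ker0 => x /(congr1 val) /=; have [y yE] := subm_prop x.
  rewrite -yE [LHS]gE gE -iterD => e; apply: val_inj; rewrite /= -yE gE.
  have : iter k2 f y = 0 by apply: (ke1 (k + k - k2)%N); rewrite subnKC // /k; lia.
  move=> e2; have -> : k = (k1.+1 + k2)%N by rewrite /k; lia.
  by rewrite iterD e2 -literE linear0.
have hs : surj h.
  apply: finlen_inj_surj hi; exists n.
  exact: ranked_injective (submval_inj (hS := submodule_range g)) rn.
have [hv [hK hvK]] := inverse_map hi hs.
pose gI : {linear M -> imgm g} :=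
  tosubm (submodule_range g) (f := g) (fun x => ex_intro _ x erefl).
exists (lcomp hv gI); split=> [x|x] /=.
  by rewrite -[RHS]hK; congr (hv _); apply: val_inj.
move=> /(congr1 h); rewrite hvK linear0 => /(congr1 val) /=; exact.
Qed.

End Ranked.

Section FinitelyGenerated.
Variable R : nzRingType.
Implicit Types M N X Y Z P Q : lmodType R.

Definition spanned M (s : seq M) (x : M) : Prop :=
  exists c : nat -> R, x = \sum_(i < size s) c i *: s`_i.

Lemma submodule_spanned M (s : seq M) : submodule (spanned s).
Proof.
split; first by exists (fun=> 0); rewrite big1 // => i _; rewrite scale0r.
move=> a x y [c ->] [c' ->]; exists (fun i => a * c i + c' i).
rewrite scaler_sumr -big_split; apply: eq_bigr => i _ /=.
by rewrite scalerDl scalerA.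
Qed.

Lemma spanned_cons M (s : seq M) x y a : spanned s y ->
  spanned (x :: s) (a *: x + y).
Proof.
move=> [c ->]; exists (fun i => if i is i'.+1 then c i' else a).
by rewrite big_ord_recl.
Qed.

Lemma finlen_fg M : finlen M -> finitely_generated M.
Proof.
move=> [n [rho [b s]]].
pose Q k := `[< exists s : seq M, rho (spanned s) = k >].
have exQ : exists k, Q k by exists (rho (spanned [::])); apply/asboolP; exists [::].
have bQ k : Q k -> (k <= n)%N.
  by move=> /asboolP [t <-]; apply: b; exact: submodule_spanned.
case: (ex_maxnP exQ bQ) => k /asboolP [t tk] kmax.
exists (size t), (fun i => t`_i) => x.
suff [c ->] : spanned t x by exists (fun i => c i).
have sub y : spanned t y -> spanned (x :: t) y.
  by move=> /(spanned_cons x 0); rewrite scale0r add0r.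
have [_] := s _ _ (submodule_spanned t) (submodule_spanned (x :: t)) sub.
apply; first by rewrite tk; apply: kmax; apply/asboolP; exists (x :: t).
by have := spanned_cons x 1 (submodule_spanned t).1; rewrite addr0 scale1r.
Qed.

Hypothesis Rlen : finlen (R^o : lmodType R).

Lemma fg_projective_onto M : finitely_generated M ->
  exists (P : lmodType R) (f : {linear P -> M}), [/\ projective P, finlen P & surj f].
Proof.
move=> [n [g gP]].
suff [P [f [prP lenP fP]]] : exists (P : lmodType R) (f : {linear P -> M}),
    [/\ projective P, finlen P &
      forall c : 'I_n -> R, exists x, f x = \sum_(i < n) c i *: g i].
  by exists P, f; split=> // y; have [c ->] := gP y; exact: fP.
elim: n g {gP} => [|n IH] g.
  have z0 := @zmod_zero R.
  exists (zmod R), (lzero (zmod R) M); split.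
  - exact: projective_zero.
  - by exists 0%N; exact: ranked_zero.
  - by move=> c; exists 0; rewrite big_ord0.
have [P [f [prP lenP fP]]] := IH (fun i => g (lift ord0 i)).
pose Ro : lmodType R := R^o.
exists (Ro * P)%type, (ladd (lcomp (lelt (g ord0)) (lfst Ro P)) (lcomp f (lsnd Ro P))).
split; [apply: projective_prod => //; exact: projective_regular|exact: finlen_prod|].
move=> c; have [x xE] := fP (fun i => c (lift ord0 i)).
by exists (c ord0, x); rewrite big_ord_recl /= xE.
Qed.

Lemma fg_finlen M : finitely_generated M -> finlen M.
Proof.
move=> /fg_projective_onto [P [f [_ [n rn] fs]]]; exists n.
exact: ranked_surjective rn.
Qed.

Lemma fgmod_finlen (M : fgmod R) : finlen M.
Proof. exact: fg_finlen (fg_gen M). Qed.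

Definition mkfg M (lenM : finlen M) : fgmod R := FGMod (finlen_fg lenM).

Definition fgprod (M N : fgmod R) : fgmod R :=
  mkfg (finlen_prod (fgmod_finlen M) (fgmod_finlen N)).

Lemma finlen_zmod : finlen (zmod R).
Proof. by exists 0%N; exact: (ranked_zero (@zmod_zero R)). Qed.

Definition fgzero : fgmod R := mkfg finlen_zmod.

Lemma finlen_sub M N (f : {linear M -> N}) : injective f -> finlen N -> finlen M.
Proof. by move=> fi [n rn]; exists n; exact: ranked_injective fi rn. Qed.

Lemma finlen_quo M N (f : {linear M -> N}) : surj f -> finlen M -> finlen N.
Proof. by move=> fi [n rn]; exists n; exact: ranked_surjective fi rn. Qed.

Lemma finlen_dsummand X Y : dsummand X Y -> finlen Y -> finlen X.
Proof.
by move=> /dsummandP [s [r sK]]; exact: finlen_sub (can_inj sK).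
Qed.

(** * Projective covers and syzygies *)

(* A projective module of least rank mapping onto [M] is a projective cover:
   if [U + ker p = P], lifting [p] through [U] gives an endomorphism of [P] with
   image in [U], whose stable image is a smaller projective mapping onto [M]. *)
Lemma projective_cover_exists M : finitely_generated M ->
  exists (P : lmodType R) (p : {linear P -> M}), projective_cover p /\ finlen P.
Proof.
move=> fgM.
pose Q n := `[< exists (P : lmodType R) (p : {linear P -> M}),
   [/\ projective P, surj p & ranked P n] >].
have exQ : exists n, Q n.
  have [P [p [prP [n rn] ps]]] := fg_projective_onto fgM.
  by exists n; apply/asboolP; exists P, p.
case: (ex_minnP exQ) => n /asboolP [P [p [prP ps rP]]] nmin.
exists P, p; split; last by exists n.
split=> // U hU UK; apply: contrapT => Unot.
pose pU := lcomp p (submval hU).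
have pUs : surj pU.
  move=> y; have [x <-] := ps y; have [u [s [Uu [ps0 ->]]]] := UK x.
  by exists (mksubm hU Uu); rewrite /= linearD ps0 addr0.
have [h hE] := prP _ _ pU p pUs.
pose f := lcomp (submval hU) h.
have pf x : p (f x) = p x := hE x.
have pfk k x : p (liter f k x) = p x.
  by elim: k => //= k IH; rewrite -IH; exact: hE.
have [|k [k0 [r [rK _]]]] := Fitting f; first by exists n.
set g := liter f k in r rK; set i := submval (submodule_range g) in rK.
have gU x : U (g x).
  by case: k k0 @g r @i rK => // k _ g r i _; exact: (subm_prop (h _)).
have ins : ~ surj i.
  move=> isj; apply: Unot => x; have [y <-] := isj x.
  by have [z zE] := subm_prop y; rewrite /= -zE; exact: gU.
have [m lt_mn rm] := ranked_proper (can_inj rK) ins rP.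
suff /nmin : Q m by rewrite leqNgt lt_mn.
apply/asboolP.
exists (imgm g), (lcomp p i); split=> //.
  by apply: projective_dsummand prP; apply/dsummandP; exists i, r.
move=> y; have [x <-] := ps y.
by exists (mksubm (submodule_range g) (ex_intro _ x erefl)) => /=; exact: pfk.
Qed.

Lemma syzygy_exists (M : fgmod R) : exists X : fgmod R, is_syzygy X M.
Proof.
have [P [p [pc lenP]]] := projective_cover_exists (fg_gen M).
have lenK : finlen (kerm p) by apply: finlen_sub lenP; exact: submval_inj.
exists (mkfg lenK), P, p, (submval (submodule_ker p)).
by split=> //; [exact: submval_inj | exact: exact_kerm].
Qed.

Lemma OmegaP (M : fgmod R) : is_syzygy (Omega M) M.
Proof.
rewrite /Omega; case: pselect => [ex|[]]; last exact: syzygy_exists.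
exact: projT2 (cid ex).
Qed.

Lemma superfluous_img M N (f : {linear M -> N}) (S : M -> Prop) :
  superfluous S -> superfluous (fun y => exists x, S x /\ f x = y).
Proof.
move=> sup U hU UK.
have Uf : forall x, U (f x).
  apply: sup; first exact: submodule_preim.
  move=> x; have [u [_ [Uu [[s [Ss <-]] e]]]] := UK (f x).
  exists (x - s), s; rewrite subrK; split=> //.
  by rewrite linearB /= e addrK.
move=> y; have [u [_ [Uu [[s [Ss <-]] ->]]]] := UK y.
by apply: submodD.
Qed.

Lemma superfluous_sum M (S T : M -> Prop) : submodule S -> submodule T ->
  superfluous S -> superfluous T ->
  superfluous (fun x => exists u v, [/\ S u, T v & x = u + v]).
Proof.
move=> hS hT supS supT U hU UK.
apply: (supS U hU); have := supT _ (submodule_sum hU hS) _.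
have UST x : exists u s, (exists u0 v, [/\ U u0, S v & u = u0 + v]) /\ T s /\ x = u + s.
  have [u [_ [Uu [[s [t [Ss Tt ->]]] ->]]]] := UK x.
  by exists (u + s), t; split; [exists u, s|rewrite -addrA].
by move=> /(_ UST) all x; have [u [v [Uu Sv ->]]] := all x; exists u, v.
Qed.

Lemma superfluous_sub M (S T : M -> Prop) : (forall x, S x -> T x) ->
  superfluous T -> superfluous S.
Proof.
move=> ST sup U hU UK; apply: sup => // x; have [u [s [Uu [Ss ->]]]] := UK x.
by exists u, s; split=> //; split=> //; exact: ST.
Qed.

Lemma projective_cover_prod P M Q N (p : {linear P -> M}) (q : {linear Q -> N}) :
  projective_cover p -> projective_cover q ->
  projective_cover (lpair (lcomp p (lfst P Q)) (lcomp q (lsnd P Q))).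
Proof.
move=> [prP ps supP] [prQ qs supQ]; split; first exact: projective_prod.
  by move=> [x y]; have [u <-] := ps x; have [v <-] := qs y; exists (u, v).
have s1 := superfluous_img (f := linl P Q) supP.
have s2 := superfluous_img (f := linr P Q) supQ.
apply: superfluous_sub (superfluous_sum _ _ s1 s2); last first.
- exact: submodule_img (submodule_ker q).
- exact: submodule_img (submodule_ker p).
move=> [x y] [px qy]; exists (x, 0), (0, y); split.
- by exists x.
- by exists y.
- by congr (_, _); rewrite /= ?addr0 ?add0r.
Qed.

Lemma kernel_iso X P M Y Q N (i : {linear X -> P}) (p : {linear P -> M})
    (j : {linear Y -> Q}) (q : {linear Q -> N})
    (h : {linear P -> Q}) (t : {linear M -> N}) :
  injective i -> exact_at i p -> injective j -> exact_at j q ->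
  injective h -> surj h -> injective t -> (forall x, q (h x) = t (p x)) ->
  isomorphic X Y.
Proof.
move=> ii ip ji jq hi hs ti sq.
have ex x : exists y, j y = h (i x).
  apply/jq; rewrite sq; have /ip -> : exists x', i x' = i x by exists x.
  by rewrite linear0.
pose f x := projT1 (cid (ex x)).
have fE x : j (f x) = h (i x) := projT2 (cid (ex x)).
have lf : linear f.
  by move=> a x y; apply: ji; rewrite fE !linearP !fE.
exists (linmap lf); split=> [x y /= e|y].
  by apply/ii/hi; rewrite -!fE e.
have [z zE] := hs (j y); have /ip [x xE] : p z = 0.
  by apply: ti; rewrite -sq zE linear0; apply/jq; exists y.
by exists x; apply: ji => /=; rewrite fE xE.
Qed.

Lemma projective_cover_unique P M Q N (p : {linear P -> M}) (q : {linear Q -> N})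
    (t : {linear M -> N}) :
  projective_cover p -> projective_cover q -> injective t -> surj t ->
  exists h : {linear P -> Q},
    [/\ injective h, surj h & forall x, q (h x) = t (p x)].
Proof.
move=> [prP ps supP] [prQ qs supQ] ti ts.
have [h hE] := prP _ _ q (lcomp t p) qs.
have hs : surj h.
  apply: (supQ (fun y => exists x, h x = y)); first exact: submodule_range.
  move=> y; have [m mE] := ts (q y); have [x xE] := ps m.
  exists (h x), (y - h x); split; first by exists x.
  by split; rewrite ?linearB /= ?hE /= ?xE ?mE ?subrr // addrCA subrr addr0.
have [s sK] := projective_section prQ hs.
have ss : surj s.
  apply: (supP (fun x => exists y, s y = x)); first exact: submodule_range.
  move=> x; exists (s (h x)), (x - s (h x)); split; first by exists (h x).
  split; last by rewrite addrCA subrr addr0.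
  apply: ti; rewrite linear0; have := hE (x - s (h x)); rewrite /= => <-.
  by rewrite linearB /= sK subrr linear0.
exists h; split=> // x y; have [u <-] := ss x; have [v <-] := ss y.
by rewrite !sK => ->.
Qed.

Lemma syzygy_unique X M Y N : isomorphic M N -> is_syzygy X M -> is_syzygy Y N ->
  isomorphic X Y.
Proof.
move=> [t [ti ts]] [P [p [i [pc ii ip]]]] [Q [q [j [qc ji jq]]]].
have [h [hi hs hE]] := projective_cover_unique pc qc ti ts.
exact: kernel_iso ii ip ji jq hi hs ti hE.
Qed.

Lemma syzygy_prod X M Y N : is_syzygy X M -> is_syzygy Y N ->
  is_syzygy (X * Y)%type (M * N)%type.
Proof.
move=> [P [p [i [pc ii ip]]]] [Q [q [j [qc ji jq]]]].
exists (P * Q)%type, (lpair (lcomp p (lfst P Q)) (lcomp q (lsnd P Q))).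
exists (lpair (lcomp i (lfst X Y)) (lcomp j (lsnd X Y))).
split; first exact: projective_cover_prod.
  by move=> [x y] [x' y'] /= [/ii -> /ji ->].
move=> [x y]; split=> [/= [/ip [u <-] /jq [v <-]]|[[u v] /= [<- <-]]].
  by exists (u, v).
congr (_, _); [by apply/ip; exists u|by apply/jq; exists v].
Qed.

Lemma syzygy_projective (X P : lmodType R) : projective P -> is_syzygy X P ->
  zero_module X.
Proof.
move=> prP [Q [q [i [[prQ qs sup] ii iq]]]].
have [s sK] := projective_section prP qs.
have ss : surj s.
  apply: (sup (fun x => exists y, s y = x)); first exact: submodule_range.
  move=> x; exists (s (q x)), (x - s (q x)); split; first by exists (q x).
  by split; rewrite ?linearB /= ?sK ?subrr // addrCA subrr addr0.
move=> x; apply: ii; rewrite linear0; have [y yE] := ss (i x).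
have : q (i x) = 0 by apply/iq; exists x.
by rewrite -yE sK => ->; rewrite linear0.
Qed.

Lemma Omega_iso (M N : fgmod R) : isomorphic M N -> isomorphic (Omega M) (Omega N).
Proof. by move=> iso; apply: syzygy_unique iso (OmegaP M) (OmegaP N). Qed.

Lemma Omega_prod (M N N' : fgmod R) : isomorphic M (N * N')%type ->
  isomorphic (Omega M) (Omega N * Omega N')%type.
Proof.
move=> iso; apply: syzygy_unique iso (OmegaP M) _.
exact: syzygy_prod (OmegaP N) (OmegaP N').
Qed.

Lemma Omega_projective (P : fgmod R) : projective P -> zero_module (Omega P).
Proof. by move=> prP; exact: syzygy_projective prP (OmegaP P). Qed.

End FinitelyGenerated.

(** * Cancellation and exchange of direct summands *)

Section Cancellation.
Variable R : nzRingType.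
Implicit Types A B M N X Y Z : lmodType R.

Definition bij M N (f : M -> N) := injective f /\ surj f.

Lemma indecomposable_endo Z (f : {linear Z -> Z}) :
  indecomposable Z -> finlen Z ->
  (exists k, forall x, iter k f x = 0) \/ bij f.
Proof.
move=> [_ ind] len; have [k [k0 [r [rK r0]]]] := Fitting f len.
set g := liter f k in r rK r0; set i := submval (submodule_range g) in rK.
have [Im0|K0] := ind _ _ (retract_iso rK).
  left; exists k => x; rewrite -literE.
  pose y : imgm g := mksubm (submodule_range g) (ex_intro _ x erefl).
  by have /(congr1 val) := Im0 y.
right; suff fs : surj f by split=> //; exact: finlen_surj_inj fs.
have irs : surj (lcomp i r).
  apply: finlen_inj_surj => //; apply: injective_ker0 => x /= e.
  have rx : r x = 0 by apply: val_inj.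
  by have /(congr1 val) := K0 (mksubm (submodule_ker r) rx).
move=> y; have [x xE] := irs y; have [z zE] := subm_prop (r x).
by exists (iter k.-1 f z); rewrite -iterS prednK // -literE; exact: etrans zE xE.
Qed.

Lemma nilpotent_compl_bij Z (f g : {linear Z -> Z}) k : finlen Z ->
  (forall x, iter k f x = 0) -> (forall x, g x + f x = x) -> bij g.
Proof.
move=> len fk gf; suff gi : injective g by split=> //; exact: finlen_inj_surj gi.
apply: injective_ker0 => x gx; have fx : f x = x by rewrite -{2}(gf x) gx add0r.
by rewrite -(fk x); elim: k {fk} => //= k <-.
Qed.

Lemma indecomposable_local Z (f g : {linear Z -> Z}) : indecomposable Z ->
  finlen Z -> (forall x, f x + g x = x) -> bij f \/ bij g.
Proof.
move=> ind len fg.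
have [[k gk]|] := indecomposable_endo g ind len; last by right.
by left; exact: nilpotent_compl_bij gk fg.
Qed.

Lemma schur_iso A B Z (f : {linear (A * Z)%type -> (B * Z)%type}) : bij f ->
  bij (fun z => (f (0, z)).2) -> isomorphic A B.
Proof.
move=> [fi fs] [di ds].
pose d := lcomp (lsnd B Z) (lcomp f (linr A Z)).
have [e [dK eK]] := @inverse_map _ _ _ d di ds.
pose c := lcomp (lsnd B Z) (lcomp f (linl A Z)).
have fE a z : (f (a, z)).2 = c a + d z.
  have -> : (a, z) = (a, 0) + (0, z) by congr (_, _); rewrite ?addr0 ?add0r.
  by rewrite linearD.
pose h := lcomp (lfst B Z) (lcomp f (lpair (lid A) (lsub (lzero A Z) (lcomp e c)))).
have hE a : f (a, 0 - e (c a)) = (h a, 0).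
  have dE : d (0 - e (c a)) = - c a by rewrite linearB linear0 eK sub0r.
  by rewrite [LHS]surjective_pairing fE dE subrr.
exists h; split.
  apply: injective_ker0 => a ha.
  by have /fi [] : f (a, 0 - e (c a)) = f 0 by rewrite hE ha linear0.
move=> b; have [[a z] az] := fs (b, 0); exists a.
have zE : 0 - e (c a) = z.
  have := fE a z; rewrite az /= => /eqP; rewrite eq_sym addr_eq0 => /eqP.
  move=> ->; rewrite linearN opprK dK; exact: add0r.
by have := hE a; rewrite zE az => -[].
Qed.

Lemma cancel_indecomposable A B Z : indecomposable Z -> finlen Z ->
  isomorphic (A * Z)%type (B * Z)%type -> isomorphic A B.
Proof.
move=> ind len /isomorphicE [f [g [fK gK]]].
have bf : bij f by split=> [|y]; [exact: can_inj fK|exists (g y)].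
pose d := lcomp (lsnd B Z) (lcomp f (linr A Z)).
pose c := lcomp (lsnd B Z) (lcomp f (linl A Z)).
pose b' := lcomp (lfst A Z) (lcomp g (linr B Z)).
pose d' := lcomp (lsnd A Z) (lcomp g (linr B Z)).
have fE a z : (f (a, z)).2 = c a + d z.
  have -> : (a, z) = (a, 0) + (0, z) by congr (_, _); rewrite ?addr0 ?add0r.
  by rewrite linearD.
have [bd|nbd] := pselect (bij d); first exact: schur_iso bf bd.
pose e := lcomp c b'.
have eE z : e z + d (d' z) = z.
  by rewrite -[in LHS]fE -surjective_pairing gK.
have be : bij e.
  have [//|[_ ds]] := @indecomposable_local _ e (lcomp d d') ind len eE.
  case: nbd; have dsj : surj d by move=> y; have [x <-] := ds y; exists (d' x).
  by split=> //; exact: finlen_surj_inj dsj.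
have [ei [eK eiK]] := inverse_map be.1 be.2.
have [[k dk]|[di _]] := indecomposable_endo (lcomp ei d) ind len; last first.
  have dij : injective d by move=> x y dxy; exact: di (congr1 ei dxy).
  by case: nbd; split=> //; exact: finlen_inj_surj dij.
have bed : bij (ladd e d).
  pose h := ladd (lid Z) (lcomp ei d).
  have [hi hs] : bij h.
    apply: (@nilpotent_compl_bij _ (lsub (lzero Z Z) (lcomp ei d)) _ k) => //.
      have sgn m x : iter m (lsub (lzero Z Z) (lcomp ei d)) x =
                 (-1) ^+ m *: iter m (lcomp ei d) x.
        elim: m => [|m IH]; first by rewrite scale1r.
        by rewrite !iterS IH exprS -scalerA scaleN1r -linearZ /= sub0r.
      by move=> x; rewrite sgn dk scaler0.
    by move=> x /=; rewrite sub0r addrK.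
  have hE x : e (h x) = ladd e d x by rewrite linearD eiK.
  split=> [x y|y]; first by rewrite -!hE => /be.1/hi.
  by have [x <-] := be.2 y; have [z <-] := hs x; exists z; rewrite -hE.
pose u := lpair (ladd (lfst A Z) (lcomp b' (lsnd A Z))) (lsnd A Z).
apply: (@schur_iso _ _ _ (lcomp f u)).
  split=> [[a z] [a' z'] /= /bf.1 [e1 e2]|y].
    by move: e1; rewrite e2 => /addIr ->.
  have [[a z] <-] := bf.2 y; exists (a - b' z, z) => /=; congr (f (_, _)).
  exact: subrK.
suff -> : (fun z => (lcomp f u (0, z)).2) = ladd e d by [].
by apply/funext => z; rewrite /= -[RHS]fE /= add0r.
Qed.

Lemma nonindecomposable_split Z : ~ zero_module Z -> ~ indecomposable Z ->
  exists A B : lmodType R,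
    [/\ isomorphic Z (A * B)%type, ~ zero_module A & ~ zero_module B].
Proof.
move=> nz nind; apply: contrapT => no; apply: nind; split=> // A B iso.
apply: contrapT => /not_orP [nA nB]; apply: no; by exists A, B.
Qed.

Lemma split_ranked Z A B n : isomorphic Z (A * B)%type -> ~ zero_module B ->
  ranked Z n -> exists2 m, (m < n)%N & ranked A m.
Proof.
move=> iso nB rZ; have rAB := ranked_iso iso rZ.
apply: (ranked_proper (f := linl A B) _ _ rAB) => [x y [] //|ss].
by apply: nB => b; have [a []] := ss (0, b).
Qed.

(* Induction along decompositions into two nonzero summands, which replaces the
   Krull-Remak-Schmidt decomposition into indecomposables. *)
Lemma decomposition_ind (Q : lmodType R -> Prop) :
  (forall Z, zero_module Z -> Q Z) ->
  (forall Z, finlen Z -> indecomposable Z -> Q Z) ->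
  (forall Z A B, finlen Z -> isomorphic Z (A * B)%type -> Q A -> Q B -> Q Z) ->
  forall Z, finlen Z -> Q Z.
Proof.
move=> Q0 Qi Qs Z [n]; elim/ltn_ind: n Z => n IH Z rZ.
have [Z0|nz] := pselect (zero_module Z); first exact: Q0.
have lenZ : finlen Z by exists n.
have [ind|nind] := pselect (indecomposable Z); first exact: Qi.
have [A [B [iso nA nB]]] := nonindecomposable_split nz nind.
have [a an ra] := split_ranked iso nB rZ.
have [b bn rb] := split_ranked (iso_trans iso (iso_prodC A B)) nA rZ.
by apply: (Qs _ _ _ lenZ iso); [exact: IH an _ ra|exact: IH bn _ rb].
Qed.

Lemma cancellation Z : finlen Z -> forall A B,
  isomorphic (A * Z)%type (B * Z)%type -> isomorphic A B.
Proof.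
move: Z; apply: decomposition_ind => [Z Z0|Z len ind|Z Z1 Z2 _ iso IH1 IH2] A B.
- move=> iso; apply: iso_trans (iso_sym (iso_prod0 A Z0)) _.
  apply: iso_trans (iso_prodC _ _) _; apply: iso_trans iso _.
  apply: iso_trans (iso_prodC _ _) _; exact: iso_prod0.
- exact: cancel_indecomposable.
- move=> isoAB; apply/IH1/IH2.
  apply: iso_trans (iso_sym (iso_prodA _ _ _)) _.
  apply: iso_trans _ (iso_prodA _ _ _).
  apply: iso_trans (iso_prod (iso_refl A) (iso_sym iso)) _.
  by apply: iso_trans isoAB (iso_prod (iso_refl B) iso).
Qed.

Lemma indecomposable_exchange Z X Y : finlen Z -> indecomposable Z ->
  dsummand Z (X * Y)%type -> dsummand Z X \/ dsummand Z Y.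
Proof.
move=> len ind /dsummandP [s [r sK]].
pose f := lcomp (lcomp r (linl X Y)) (lcomp (lfst X Y) s).
pose g := lcomp (lcomp r (linr X Y)) (lcomp (lsnd X Y) s).
have fg x : f x + g x = x.
  rewrite /= -linearD /= -[RHS]sK; congr (r _).
  by rewrite [RHS]surjective_pairing; congr (_, _); rewrite /= ?addr0 ?add0r.
case: (indecomposable_local ind len fg) => -[fi fs];
  have [h [fK _]] := inverse_map fi fs; [left|right]; apply/dsummandP.
- exists (lcomp (lfst X Y) s), (lcomp h (lcomp r (linl X Y))); exact: fK.
- exists (lcomp (lsnd X Y) s), (lcomp h (lcomp r (linr X Y))); exact: fK.
Qed.

Lemma simple_indecomposable Z : simple Z -> indecomposable Z.
Proof.
move=> [nz sZ]; split=> // A B /isomorphicE [f [g [fK gK]]].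
have [K0|Kall] := sZ _ (submodule_ker (lcomp (lfst A B) f)).
  right=> b; have : g (0, b) = 0 by apply: K0; rewrite /= gK.
  by move/(congr1 f); rewrite gK linear0 => -[].
by left=> a; have := Kall (g (a, 0)); rewrite /= gK.
Qed.

End Cancellation.

(** * Isomorphism classes and the group K_0 *)

Section EquivalenceClasses.
Variables (T : choiceType) (e : T -> T -> Prop).

Definition class_repr (x : T) : T := choose (fun y => `[< e x y >]) x.

Definition classes (er : forall x, e x x) (es : forall x y, e x y -> e y x)
  (et : forall x y z, e x y -> e y z -> e x z) := {x : T | class_repr x == x}.

Hypotheses (er : forall x, e x x) (es : forall x y, e x y -> e y x)
  (et : forall x y z, e x y -> e y z -> e x z).
Notation Q := (classes er es et).

HB.instance Definition _ := SubType.copy Q {x : T | class_repr x == x}.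
HB.instance Definition _ := [Choice of Q by <:].

Lemma class_reprP x : e x (class_repr x).
Proof.
by apply/asboolP; apply: (@chooseP _ (fun y => `[< e x y >])); exact/asboolP/er.
Qed.

Lemma class_repr_eq x y : e x y -> class_repr x = class_repr y.
Proof.
move=> exy; rewrite /class_repr.
have eq : (fun z => `[< e x z >]) =1 (fun z => `[< e y z >]).
  by move=> z; apply/asboolP/asboolP; apply: et => //; exact: es.
by rewrite (eq_choose eq); apply: choose_id; apply/asboolP => //; exact: es.
Qed.

Lemma class_repr_idem x : class_repr (class_repr x) == class_repr x.
Proof. by apply/eqP/class_repr_eq/es/class_reprP. Qed.

Definition toclass x : Q := exist _ (class_repr x) (class_repr_idem x).

Lemma toclassP x y : toclass x = toclass y <-> e x y.
Proof.
split=> [/(congr1 val) /= exy|/class_repr_eq exy]; last exact: val_inj.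
apply: et (class_reprP x) _; rewrite exy; exact/es/class_reprP.
Qed.

Lemma toclass_val (q : Q) : toclass (val q) = q.
Proof. by apply: val_inj => /=; apply/eqP; exact: (valP q). Qed.

Lemma toclass_repr x : e (val (toclass x)) x.
Proof. by apply/toclassP; exact: toclass_val. Qed.

End EquivalenceClasses.

Section IsoClasses.
Variable R : nzRingType.
Implicit Types M N X P : fgmod R.

Definition presentation : Type := {n : nat & ('I_n -> R) -> Prop}.

Definition presents (c : presentation) (M : lmodType R) : Prop :=
  exists g : 'I_(projT1 c) -> M,
    (forall x, exists k, x = \sum_i k i *: g i) /\
    (forall k, projT2 c k <-> \sum_i k i *: g i = 0).

Lemma presents_exists M : exists c, presents c M.
Proof.
have [n [g gP]] := fg_gen M.
by exists (existT _ n (fun k => \sum_i k i *: g i = 0)), g.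
Qed.

Lemma presents_iso_closed c (M N : lmodType R) : isomorphic M N ->
  presents c M -> presents c N.
Proof.
move=> /isomorphicE [f [h [fK hK]]] [g [gs gr]].
have fE k : f (\sum_i k i *: g i) = \sum_i k i *: f (g i).
  by rewrite linear_sum; apply: eq_bigr => i _; rewrite linearZ.
exists (fun i => f (g i)); split=> [y|k].
  by have [k kE] := gs (h y); exists k; rewrite -fE -kE hK.
rewrite -fE; split=> [/gr ->|e]; first exact: linear0.
by apply/gr; rewrite -[LHS]fK e linear0.
Qed.

Lemma presents_iso c (M N : lmodType R) :
  presents c M -> presents c N -> isomorphic M N.
Proof.
move=> [g [gs gr]] [h [hs hr]].
pose k x := projT1 (cid (gs x)).
have kE x : x = \sum_i k x i *: g i := projT2 (cid (gs x)).
pose sg (u : 'I_(projT1 c) -> R) := \sum_i u i *: g i.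
pose sh (u : 'I_(projT1 c) -> R) := \sum_i u i *: h i.
have shB (a : R) u v : sh (fun i => a * u i + v i) = a *: sh u + sh v.
  rewrite /sh scaler_sumr -big_split; apply: eq_bigr => i _ /=.
  by rewrite scalerDl scalerA.
have sgB (a : R) u v : sg (fun i => a * u i + v i) = a *: sg u + sg v.
  rewrite /sg scaler_sumr -big_split; apply: eq_bigr => i _ /=.
  by rewrite scalerDl scalerA.
have eq0 u : sg u = 0 <-> sh u = 0 by split=> [/gr/hr|/hr/gr].
have eqv u v : sg u = sg v <-> sh u = sh v.
  have := eq0 (fun i => (-1) * u i + v i); rewrite shB sgB !scaleN1r => -[h1 h2].
  by split=> e; apply/esym/eqP; rewrite -subr_eq0 addrC; apply/eqP;
    [apply: h1|apply: h2]; rewrite e addNr.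
have kS u : sh (k (sg u)) = sh u by apply/eqv; rewrite -[LHS]kE.
have lin : linear (fun x => sh (k x)).
  by move=> a x y; rewrite {1}(kE x) {1}(kE y) -shB -sgB kS.
exists (linmap lin); split=> [x y /= /eqv|y]; first by rewrite /sg -!kE.
by have [u ->] := hs y; exists (sg u) => /=; exact: kS.
Qed.

(* Isomorphism classes are encoded by their sets of presentations, because the
   type [fgmod R] itself is too large to carry algebraic structures. *)
Definition icode M : presentation -> bool := fun c => `[< presents c M >].

Lemma icodeP M N : icode M = icode N <-> isomorphic M N.
Proof.
split=> [e|iso].
  have [c cM] := presents_exists M; apply: (presents_iso cM).
  by apply/asboolP; rewrite -[asbool _]/(icode N c) -e; apply/asboolP.
apply/funext => c; apply/asboolP/asboolP; apply: presents_iso_closed => //.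
exact: iso_sym.
Qed.

Definition isoc (_ : finlen (R^o : lmodType R)) :=
  {c : presentation -> bool | `[< exists M, icode M = c >]}.

Hypothesis Rlen : finlen (R^o : lmodType R).
Notation I := (isoc Rlen).

HB.instance Definition _ := SubType.copy I
  {c : presentation -> bool | `[< exists M, icode M = c >]}.
HB.instance Definition _ := [Choice of I by <:].

Definition ic M : I := exist _ (icode M) (introT (asboolP _) (ex_intro _ M erefl)).

Lemma icP M N : ic M = ic N <-> isomorphic M N.
Proof. by rewrite -icodeP; split=> [/(congr1 val)|e] //; exact: val_inj. Qed.

Lemma icE (x : I) : exists M, ic M = x.
Proof.
by have /asboolP [M ME] := valP x; exists M; exact: val_inj.
Qed.

Definition imod (x : I) : fgmod R := projT1 (cid (icE x)).

Lemma imodK x : ic (imod x) = x. Proof. exact: projT2 (cid (icE x)). Qed.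

Lemma imod_ic M : isomorphic (imod (ic M)) M.
Proof. by apply/icP; exact: imodK. Qed.

Definition isoc_add (x y : I) : I := ic (fgprod Rlen (imod x) (imod y)).
Definition isoc_zero : I := ic (fgzero R).

Lemma isoc_addE M N : isoc_add (ic M) (ic N) = ic (fgprod Rlen M N).
Proof. by apply/icP; apply: iso_prod; exact: imod_ic. Qed.

Lemma isoc_addA : associative isoc_add.
Proof.
move=> x y z; have [M <-] := icE x; have [N <-] := icE y; have [X <-] := icE z.
by rewrite !isoc_addE; apply/icP; exact: iso_prodA.
Qed.

Lemma isoc_addC : commutative isoc_add.
Proof.
move=> x y; have [M <-] := icE x; have [N <-] := icE y.
by rewrite !isoc_addE; apply/icP; exact: iso_prodC.
Qed.

Lemma isoc_add0 : left_id isoc_zero isoc_add.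
Proof.
move=> x; have [M <-] := icE x; rewrite isoc_addE; apply/icP.
exact: iso_prod0 (@zmod_zero R).
Qed.

HB.instance Definition _ :=
  GRing.isNmodule.Build I isoc_addA isoc_addC isoc_add0.

Lemma ic_prod M N X : isomorphic M (N * X)%type -> ic M = ic N + ic X.
Proof. by move=> iso; rewrite [RHS]isoc_addE; apply/icP. Qed.

Lemma ic_prodE M N X : ic M = ic N + ic X -> isomorphic M (N * X)%type.
Proof. by move=> e; apply/(icP M (fgprod Rlen N X)); rewrite e [LHS]isoc_addE. Qed.

Lemma ic_cancel (x y z : I) : x + z = y + z -> x = y.
Proof.
have [M <-] := icE x; have [N <-] := icE y; have [X <-] := icE z.
rewrite ![_ + ic X]isoc_addE => /icP iso; apply/icP.
exact: cancellation (fgmod_finlen Rlen X) _ _ iso.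
Qed.

Definition iproj (x : I) := projective (imod x).

Lemma iproj_ic P : iproj (ic P) <-> projective P.
Proof.
by split; apply: projective_iso; [|apply: iso_sym]; exact: imod_ic.
Qed.

Lemma iproj0 : iproj 0.
Proof. by apply/iproj_ic; apply: projective_zero; exact: zmod_zero. Qed.

Lemma iprojD x y : iproj x -> iproj y -> iproj (x + y).
Proof.
by move=> px py; apply/iproj_ic; exact: projective_prod.
Qed.

Definition gro_rel (a b : I * I) : Prop := exists p q,
  [/\ iproj p, iproj q & a.1 + b.2 + p = b.1 + a.2 + q].

Lemma gro_refl a : gro_rel a a.
Proof. by exists 0, 0; split=> //; exact: iproj0. Qed.

Lemma gro_sym a b : gro_rel a b -> gro_rel b a.
Proof. by move=> [p [q [pp pq e]]]; exists q, p. Qed.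

Lemma gro_trans a b c : gro_rel a b -> gro_rel b c -> gro_rel a c.
Proof.
move=> [p [q [pp pq e]]] [p' [q' [pp' pq' e']]].
exists (p + p'), (q + q'); split; [exact: iprojD|exact: iprojD|].
apply: (ic_cancel (z := b.1 + b.2)).
transitivity ((a.1 + b.2 + p) + (b.1 + c.2 + p')).
  by rewrite (AC ((2*2)*2) (((1*6)*3)*((5*2)*4))).
by rewrite e e' (AC (3*3) (((4*2)*(3*6))*(1*5))).
Qed.

End IsoClasses.

Section Grothendieck.
Variable R : nzRingType.

Definition gro (h : finlen (R^o : lmodType R)) :=
  classes (@gro_refl R h) (@gro_sym R h) (@gro_trans R h).

HB.instance Definition _ h := Choice.copy (gro h)
  (classes (@gro_refl R h) (@gro_sym R h) (@gro_trans R h)).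

Hypothesis Rlen : finlen (R^o : lmodType R).
Notation I := (isoc Rlen).
Notation G := (gro Rlen).

Definition gdiff (a : I * I) : G := toclass _ _ _ a.

Lemma gdiffP a b : gdiff a = gdiff b <-> gro_rel a b.
Proof. exact: toclassP. Qed.

Lemma gdiffE (g : G) : exists a, gdiff a = g.
Proof. by exists (val g); exact: toclass_val. Qed.

Lemma gdiff_val a : gro_rel (val (gdiff a)) a.
Proof. exact: toclass_repr. Qed.

Definition gro_add (x y : G) : G := gdiff (val x + val y).
Definition gro_opp (x : G) : G := gdiff ((val x).2, (val x).1).
Definition gro_zero : G := gdiff 0.

Lemma gro_addE a b : gro_add (gdiff a) (gdiff b) = gdiff (a + b).
Proof.
apply/gdiffP; have [p [q [pp pq e]]] := gdiff_val a.
have [p' [q' [pp' pq' e']]] := gdiff_val b.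
exists (p + p'), (q + q'); split; [exact: iprojD|exact: iprojD|].
move: e e'; move: (val (gdiff a)) (val (gdiff b)) => [u v] [u' v'].
case: a b => [w z] [w' z'] /=.
move=> e e'; rewrite (AC ((2*2)*2) (((1*3)*5)*((2*4)*6))) /= e e'.
by rewrite (AC (3*3) (((1*4)*(2*5))*(3*6))).
Qed.

Lemma gro_oppE a : gro_opp (gdiff a) = gdiff (a.2, a.1).
Proof.
apply/gdiffP; have [p [q [pp pq e]]] := gdiff_val a.
exists q, p; split=> //; rewrite /gro_opp; move: e; move: (val (gdiff a)) => [u v].
by case: a => w z /= e; rewrite [v + w]addrC -e [z + u]addrC.
Qed.

Lemma gro_addA : associative gro_add.
Proof.
move=> x y z; have [a <-] := gdiffE x; have [b <-] := gdiffE y.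
by have [c <-] := gdiffE z; rewrite !gro_addE addrA.
Qed.
Lemma gro_addC : commutative gro_add.
Proof. by move=> x y; rewrite /gro_add addrC. Qed.
Lemma gro_add0 : left_id gro_zero gro_add.
Proof. by move=> x; have [a <-] := gdiffE x; rewrite gro_addE add0r. Qed.
Lemma gro_addN : left_inverse gro_zero gro_opp gro_add.
Proof.
move=> x; have [a <-] := gdiffE x; rewrite gro_oppE gro_addE; apply/gdiffP.
exists 0, 0; split; [exact: iproj0|exact: iproj0|case: a => u v /=].
by rewrite !addr0 !add0r addrC.
Qed.

HB.instance Definition _ :=
  GRing.isZmodule.Build G gro_addA gro_addC gro_add0 gro_addN.

Fixpoint k0cl (x : K0 R) : G :=
  match x with
  | K0class M => gdiff (ic Rlen M, 0)
  | K0zero => 0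
  | K0add x y => k0cl x + k0cl y
  | K0opp x => - k0cl x
  end.

Lemma gdiffD a b : gdiff (a + b) = gdiff a + gdiff b.
Proof. by rewrite -gro_addE. Qed.

Lemma k0cl_sound x y : K0eq x y -> k0cl x = k0cl y.
Proof.
elim=> //= {x y}.
- by move=> x y z _ -> _ ->.
- by move=> x x' y y' _ -> _ ->.
- by move=> x x' _ ->.
- by move=> x y z; rewrite addrA.
- by move=> x y; rewrite addrC.
- by move=> x; rewrite add0r.
- by move=> x; rewrite addNr.
- by move=> M N /icP ->.
- move=> P prP; apply/gdiffP; exists 0, (ic Rlen P); split.
  + exact: iproj0.
  + by apply/iproj_ic.
  + by rewrite /= !addr0 !add0r.
- move=> M N N' /(ic_prod Rlen) ->; rewrite -gdiffD; congr gdiff.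
  by congr (_, _); rewrite /= addr0.
Qed.

Lemma K0eq_addr (x x' z : K0 R) : K0eq x x' -> K0eq (K0add x z) (K0add x' z).
Proof. by move=> e; apply: K0eq_add => //; exact: K0eq_refl. Qed.

Lemma K0eq_addl (x x' z : K0 R) : K0eq x x' -> K0eq (K0add z x) (K0add z x').
Proof. by move=> e; apply: K0eq_add => //; exact: K0eq_refl. Qed.

Lemma K0eq_ACA (x y z w : K0 R) :
  K0eq (K0add (K0add x y) (K0add z w)) (K0add (K0add x z) (K0add y w)).
Proof.
apply: K0eq_trans (K0eq_sym (K0eq_addA _ _ _)) _.
apply: K0eq_trans _ (K0eq_addA _ _ _); apply: K0eq_addl.
apply: K0eq_trans (K0eq_addA _ _ _) _; apply: K0eq_trans _ (K0eq_sym (K0eq_addA _ _ _)).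
by apply: K0eq_addr; exact: K0eq_addC.
Qed.

Lemma K0eq_cancel (x y z : K0 R) : K0eq (K0add x z) (K0add y z) -> K0eq x y.
Proof.
have zK w : K0eq (K0add (K0opp z) (K0add w z)) w.
  apply: K0eq_trans (K0eq_addl _ (K0eq_addC _ _)) _.
  apply: K0eq_trans (K0eq_addA _ _ _) _.
  by apply: K0eq_trans (K0eq_addr _ (K0eq_addN _)) _; exact: K0eq_add0.
move=> e; apply: K0eq_trans (K0eq_sym (zK x)) _.
by apply: K0eq_trans (zK y); exact: K0eq_addl.
Qed.

Lemma K0eq_fgprod (M N : fgmod R) :
  K0eq (K0class (fgprod Rlen M N)) (K0add (K0class M) (K0class N)).
Proof. by apply: K0eq_dsum; exact: iso_refl. Qed.

Lemma K0eq_fgzero : K0eq (K0class (fgzero R)) (K0zero R).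
Proof. by apply: K0eq_proj; apply: projective_zero; exact: zmod_zero. Qed.

Lemma K0_diff (x : K0 R) : exists M N : fgmod R,
  K0eq (K0add x (K0class N)) (K0class M).
Proof.
elim: x => [M||x [M [N e]] y [M' [N' e']]|x [M [N e]]].
- exists M, (fgzero R); apply/K0eq_sym/K0eq_dsum.
  apply: iso_trans (iso_sym (iso_prod0 M (@zmod_zero R))) _; exact: iso_prodC.
- by exists (fgzero R), (fgzero R); exact: K0eq_add0.
- exists (fgprod Rlen M M'), (fgprod Rlen N N').
  apply: K0eq_trans (K0eq_addl _ (K0eq_fgprod _ _)) _.
  apply: K0eq_trans (K0eq_ACA _ _ _ _) _.
  by apply: K0eq_trans (K0eq_add e e') _; exact/K0eq_sym/K0eq_fgprod.
- exists N, M; apply: K0eq_trans (K0eq_addl _ (K0eq_sym e)) _.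
  apply: K0eq_trans (K0eq_addA _ _ _) _.
  by apply: K0eq_trans (K0eq_addr _ (K0eq_addN _)) _; exact: K0eq_add0.
Qed.

Lemma k0cl_class_eq (M N : fgmod R) : k0cl (K0class M) = k0cl (K0class N) ->
  exists P Q : fgmod R, [/\ projective P, projective Q &
    isomorphic (M * P)%type (N * Q)%type].
Proof.
move=> /gdiffP [p [q [pp pq]]]; rewrite /= !addr0 -(imodK p) -(imodK q) => e.
exists (imod p), (imod q); split=> //.
by apply: (@ic_prodE _ Rlen (fgprod Rlen M (imod p))); rewrite -e [RHS]isoc_addE.
Qed.

Lemma k0cl_complete x y : k0cl x = k0cl y -> K0eq x y.
Proof.
move=> exy; have [M [N e]] := K0_diff x; have [M' [N' e']] := K0_diff y.
have : k0cl (K0class (fgprod Rlen M N')) = k0cl (K0class (fgprod Rlen M' N)).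
  rewrite (k0cl_sound (K0eq_fgprod M N')) (k0cl_sound (K0eq_fgprod M' N)).
  rewrite [LHS]/= [RHS]/= -[gdiff (ic _ M, 0)]/(k0cl (K0class M)).
  rewrite -[gdiff (ic _ M', 0)]/(k0cl (K0class M')).
  by rewrite -(k0cl_sound e) -(k0cl_sound e') /= exy addrAC.
move=> /k0cl_class_eq [P [Q [prP prQ iso]]].
have eq : K0eq (K0add (K0class M) (K0class N')) (K0add (K0class M') (K0class N)).
  have absorb (X Y : fgmod R) : projective Y ->
      K0eq (K0class (fgprod Rlen X Y)) (K0class X).
    move=> prY; apply: K0eq_trans (K0eq_fgprod _ _) _.
    apply: K0eq_trans (K0eq_addl _ (K0eq_proj prY)) _.
    by apply: K0eq_trans (K0eq_addC _ _) _; exact: K0eq_add0.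
  apply: K0eq_trans (K0eq_sym (K0eq_fgprod _ _)) _.
  apply: K0eq_trans _ (K0eq_fgprod _ _).
  apply: K0eq_trans (K0eq_sym (absorb _ _ prP)) _.
  by apply: K0eq_trans _ (absorb _ _ prQ); apply: K0eq_iso.
apply: (K0eq_cancel (z := K0add (K0class N) (K0class N'))).
apply: K0eq_trans (K0eq_addA _ _ _) _.
apply: K0eq_trans (K0eq_addr _ e) _; apply: K0eq_trans eq _.
apply: K0eq_trans (K0eq_addr _ (K0eq_sym e')) _.
apply: K0eq_trans (K0eq_sym (K0eq_addA _ _ _)) _.
by apply: K0eq_addl; exact: K0eq_addC.
Qed.

Lemma k0clP x y : k0cl x = k0cl y <-> K0eq x y.
Proof. by split=> [/k0cl_complete|/k0cl_sound]. Qed.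

Lemma K0L_congr (x y : K0 R) : K0eq x y -> K0eq (K0L x) (K0L y).
Proof.
elim=> {x y} /=.
- by move=> x; exact: K0eq_refl.
- by move=> x y _ /K0eq_sym.
- by move=> x y z _ e _; exact: K0eq_trans e.
- by move=> x x' y y' _ e _; exact: K0eq_add e.
- by move=> x x' _ e; exact: K0eq_opp.
- by move=> x y z; exact: K0eq_addA.
- by move=> x y; exact: K0eq_addC.
- by move=> x; exact: K0eq_add0.
- by move=> x; exact: K0eq_addN.
- by move=> M N iso; apply: K0eq_iso; exact: Omega_iso.
- move=> P prP; apply: K0eq_proj; apply: projective_zero.
  exact: Omega_projective.
- by move=> M N N' iso; apply: K0eq_dsum; exact: Omega_prod.
Qed.

Lemma iterK0L_congr m (x y : K0 R) : K0eq x y ->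
  K0eq (iter m (@K0L R) x) (iter m (@K0L R) y).
Proof. by move=> e; elim: m => //= m; exact: K0L_congr. Qed.

Lemma iterK0LD m (x y : K0 R) :
  iter m (@K0L R) (K0add x y) = K0add (iter m (@K0L R) x) (iter m (@K0L R) y).
Proof. by elim: m => //= m ->. Qed.

Lemma iterK0LN m (x : K0 R) :
  iter m (@K0L R) (K0opp x) = K0opp (iter m (@K0L R) x).
Proof. by elim: m => //= m ->. Qed.

Lemma iterK0L0 m : iter m (@K0L R) (K0zero R) = K0zero R.
Proof. by elim: m => //= m ->. Qed.

Lemma iterK0L_class m (M : fgmod R) :
  iter m (@K0L R) (K0class M) = K0class (Omegan m M).
Proof. by elim: m => //= m ->. Qed.

End Grothendieck.

(** * Finitely generated abelian groups *)

Section AbelianGroups.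
Variable V : zmodType.
Implicit Types (S H : V -> Prop) (s : seq V).

Definition zsub S := S 0 /\ forall x y, S x -> S y -> S (x - y).

Lemma zsubN S x : zsub S -> S x -> S (- x).
Proof. by move=> [S0 SB] Sx; rewrite -sub0r; exact: SB. Qed.

Lemma zsubD S x y : zsub S -> S x -> S y -> S (x + y).
Proof. by move=> hS Sx Sy; rewrite -[y]opprK; apply: hS.2 => //; exact: zsubN. Qed.

Lemma zsubZ S x k : zsub S -> S x -> S (x *~ k).
Proof.
move=> hS Sx; have nat n : S (x *+ n).
  by elim: n => [|n IH]; rewrite ?mulr0n ?mulrS; [exact: hS.1|exact: zsubD].
by case: k => n; rewrite ?NegzE ?mulrNz; [exact: nat|apply: zsubN => //; exact: nat].
Qed.

Lemma zsub_sum S n (F : nat -> V) : zsub S -> (forall i, (i < n)%N -> S (F i)) ->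
  S (\sum_(i < n) F i).
Proof.
move=> hS SF; elim/big_ind: _ => //; first exact: hS.1.
  by move=> x y; exact: zsubD.
by move=> i _; exact: SF.
Qed.

Fixpoint zspan s : V -> Prop :=
  if s is a :: s' then fun x => exists k, zspan s' (x - a *~ k) else fun x => x = 0.

Lemma zsub_zspan s : zsub (zspan s).
Proof.
elim: s => [|a s IH] /=; first by split=> // x y -> ->; rewrite subr0.
split; first by exists 0; rewrite mulr0z subr0; exact: IH.1.
move=> x y [k xk] [l yl]; exists (k - l).
have := IH.2 _ _ xk yl; congr (zspan s _).
by rewrite mulrzBr !opprB (AC (2*2) ((1*4)*(3*2))).
Qed.

Lemma zspan_mem s x : x \in s -> zspan s x.
Proof.
elim: s => // a s IH; rewrite in_cons => /orP [/eqP ->|/IH xs] /=.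
  by exists 1; rewrite mulr1z subrr; exact: (zsub_zspan s).1.
by exists 0; rewrite mulr0z subr0.
Qed.

Lemma zspan_noetherian s (N : nat -> V -> Prop) :
  (forall m, zsub (N m)) -> (forall m x, N m x -> N m.+1 x) ->
  (forall m x, N m x -> zspan s x) ->
  exists n, forall m x, (n <= m)%N -> N m x -> N n x.
Proof.
elim: s N => [|a s IH] N hN inc sp.
  by exists 0%N => m x _ /sp /= ->; exact: (hN 0%N).1.
have mono m m' x : (m <= m')%N -> N m x -> N m' x.
  by move=> /subnK <-; elim: (m' - m)%N => // d IHd /IHd; exact: inc.
have [|||n1 n1P] := IH (fun m x => N m x /\ zspan s x).
- move=> m; split; first by split; [exact: (hN m).1|exact: (zsub_zspan s).1].
  by move=> x y [Nx sx] [Ny sy]; split; [exact: (hN m).2|exact: (zsub_zspan s).2].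
- by move=> m x [/inc].
- by move=> m x [].
pose Q g := `[< exists m x, [/\ N m x, (0 < g)%N & zspan s (x - a *~ g%:Z)] >].
have [exQ|noQ] := pselect (exists g, Q g); last first.
  exists n1 => m x le Nx; have [k sk] := sp _ _ Nx.
  apply: (n1P m x le _).1; split=> //.
  suff k0 : k = 0 by move: sk; rewrite k0 mulr0z subr0.
  apply: contrapT => kn; case: noQ; exists `|k|%N; apply/asboolP.
  case: k sk kn => k sk kn; first by exists m, x; split=> //=; lia.
  exists m, (- x); split; [exact: zsubN|by []|].
  by have := zsubN (zsub_zspan s) sk; rewrite NegzE mulrNz opprK opprD abszN.
case: (ex_minnP exQ) => g /asboolP [n0 [c0 [Nc0 g0 sc0]]] gmin.
exists (maxn n0 n1) => m x le Nx; have [k sk] := sp _ _ Nx.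
pose q := (k %/ g%:Z)%Z; pose y := x - c0 *~ q.
have Ny : N m y.
  apply: (hN m).2 => //; apply: zsubZ => //; apply: mono Nc0.
  by apply: leq_trans le; exact: leq_maxl.
have sy : zspan s (y - a *~ (k %% g%:Z)%Z).
  have -> : (k %% g%:Z)%Z = k - q * g%:Z by [].
  rewrite /y mulrzBr.
  have := (zsub_zspan s).2 _ _ sk (zsubZ q (zsub_zspan s) sc0).
  rewrite mulrzBl -mulrzA [g%:Z * _]mulrC -/q; congr (zspan s _).
  by rewrite !opprB (AC (2*2) ((1*4)*(3*2))).
have r0 : (k %% g%:Z)%Z = 0.
  apply: contrapT => rn.
  have r_ge0 : 0 <= (k %% g%:Z)%Z by apply: modz_ge0; lia.
  have r_lt : (k %% g%:Z)%Z < g%:Z by apply: ltz_pmod; lia.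
  move: sy rn r_ge0 r_lt; case: (k %% g%:Z)%Z => // r sy rn _ r_lt.
  have : (g <= r)%N by apply: gmin; apply/asboolP; exists m, y; split=> //; lia.
  lia.
move: sy; rewrite r0 mulr0z subr0 => sy.
have [|Ny1 _] := n1P m y (leq_trans (leq_maxr _ _) le); first by [].
rewrite -(subrK (c0 *~ q) x); apply: zsubD; first exact: hN.
  by apply: mono Ny1; exact: leq_maxr.
by apply: zsubZ; first exact: hN; apply: mono Nc0; exact: leq_maxl.
Qed.


Section InjectiveEndomorphism.
Variables (s : seq V) (H : V -> Prop) (phi : V -> V).
Hypotheses (hH : zsub H) (Hs : forall x, H x -> zspan s x).
Hypotheses (phiH : forall x, H x -> H (phi x))
  (phiB : forall x y, H x -> H y -> phi (x - y) = phi x - phi y)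
  (phi0 : forall x, H x -> phi x = 0 -> x = 0).

Lemma endo_zero : phi 0 = 0.
Proof. by rewrite -[in LHS](subrr 0) phiB ?subrr //; exact: hH.1. Qed.

Lemma endoD x y : H x -> H y -> phi (x + y) = phi x + phi y.
Proof.
move=> Hx Hy; have HNy := zsubN hH Hy.
rewrite -{1}[y]opprK phiB // -[- y]sub0r phiB ?endo_zero ?sub0r ?opprK //.
exact: hH.1.
Qed.

Lemma endoZ x k : H x -> phi (x *~ k) = phi x *~ k.
Proof.
move=> Hx; have nat n : phi (x *+ n) = phi x *+ n.
  elim: n => [|n IH]; first by rewrite !mulr0n endo_zero.
  by rewrite !mulrS endoD ?IH //; exact: (zsubZ n hH Hx).
case: k => n; rewrite ?NegzE ?mulrNz; first exact: nat.
rewrite -sub0r phiB; [|exact: hH.1|exact: (zsubZ n.+1 hH Hx)].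
by rewrite endo_zero sub0r nat.
Qed.

Lemma endo_sum n (F : nat -> V) : (forall i, H (F i)) ->
  phi (\sum_(i < n) F i) = \sum_(i < n) phi (F i).
Proof.
move=> HF; elim: n => [|n IH]; first by rewrite !big_ord0 endo_zero.
by rewrite !big_ord_recr /= endoD ?IH //; apply: (zsub_sum (F := F)).
Qed.

(* The chain of subgroups spanned by x, phi x, ..., phi^k x stabilises, which
   gives a monic relation; its first nonzero coefficient is moved to degree 0
   by injectivity. *)
Lemma torsion_cokernel x : H x ->
  exists2 k : int, k != 0 & exists2 y, H y & x *~ k = phi y.
Proof.
move=> Hx; have Hit i : H (iter i phi x) by elim: i => //= i; exact: phiH.
pose N k v := exists c : nat -> int, v = \sum_(i < k) iter i phi x *~ c i.
have HN k (c : nat -> int) : H (\sum_(i < k) iter i phi x *~ c i).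
  by apply: (zsub_sum (F := fun i => iter i phi x *~ c i)) => // i _; exact: zsubZ.
have [|||n nP] := @zspan_noetherian s N.
- move=> m; split; first by exists (fun=> 0); rewrite big1 // => i _; rewrite mulr0z.
  move=> _ _ [c ->] [d ->]; exists (fun i => c i - d i).
  by rewrite -sumrB; apply: eq_bigr => i _; rewrite mulrzBr.
- move=> m _ [c ->]; exists (fun i => if (i < m)%N then c i else 0).
  rewrite big_ord_recr /= ltnn mulr0z addr0; apply: eq_bigr => i _.
  by rewrite ltn_ord.
- by move=> m _ [c ->]; apply: Hs; exact: HN.
have [|c cE] := nP n.+1 (iter n phi x) (leqnSn n).
  exists (fun i => (i == n)%:Z); rewrite big_ord_recr /= eqxx mulr1z.
  by rewrite big1 ?add0r // => i _; rewrite ltn_eqF ?ltn_ord // mulr0z.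
elim: n c cE {nP} => [|n IH] c cE.
  exists 1; first by [].
  exists 0; first exact: hH.1.
  by rewrite endo_zero mulr1z; move: cE; rewrite big_ord0.
pose y := iter n phi x - \sum_(i < n) iter i phi x *~ c i.+1.
have Hy : H y by apply: hH.2 => //; exact: (HN n (fun i => c i.+1)).
have yE : x *~ c 0%N = phi y.
  rewrite /y phiB //; last exact: (HN n (fun i => c i.+1)).
  rewrite (@endo_sum n (fun i => iter i phi x *~ c i.+1)); last first.
    by move=> i; exact: zsubZ.
  rewrite -iterS cE big_ord_recl /= -addrA.
  rewrite [X in _ + X](_ : _ = 0) ?addr0 //; apply/eqP; rewrite subr_eq0; apply/eqP.
  by apply: eq_bigr => i _; rewrite endoZ.
have [c0|cn] := eqVneq (c 0%N) 0; last by exists (c 0%N) => //; exists y.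
apply: (IH (fun i => c i.+1)); apply/eqP; rewrite -subr_eq0; apply/eqP.
by apply: phi0 => //; rewrite -yE c0 mulr0z.
Qed.

End InjectiveEndomorphism.
End AbelianGroups.

(** * Extended naturals *)

Lemma ele_refl x : ele x x. Proof. by case: x => //= n; exact: leqnn. Qed.

Lemma ele_trans y x z : ele x y -> ele y z -> ele x z.
Proof. by case: x y z => [m|] [n|] [p|] //=; exact: leq_trans. Qed.

Lemma einf_leP (S : enat -> Prop) n :
  ele (einf S) (Fin n) <-> exists2 y, S y & ele y (Fin n).
Proof.
have [lb glb] := einfP S; split=> [le|[y Sy yn]]; last exact: ele_trans (lb _ Sy) yn.
apply: contrapT => no.
have : ele (Fin n.+1) (einf S).
  apply: glb => -[m|] Sy //=; rewrite ltnNge; apply/negP => mn.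
  by apply: no; exists (Fin m).
by case: (einf S) le => //= k kn nk; have := leq_ltn_trans kn nk; rewrite ltnn.
Qed.

Lemma ninf_leP (P : nat -> Prop) n :
  ele (ninf P) (Fin n) <-> exists2 m, P m & (m <= n)%N.
Proof.
rewrite einf_leP; split=> [[_ [m Pm ->] mn]|[m Pm mn]]; first by exists m.
by exists (Fin m) => //; exists m.
Qed.

Lemma ninf_fin (P : nat -> Prop) n : ninf P = Fin n -> P n.
Proof.
move=> e; have /ninf_leP [m Pm mn] : ele (ninf P) (Fin n) by rewrite e; exact: ele_refl.
have : ele (ninf P) (Fin m) by apply/ninf_leP; exists m.
by rewrite e /= => nm; have -> : n = m by apply/eqP; rewrite eqn_leq nm.
Qed.

Lemma esup_leP (S : enat -> Prop) z :
  ele (esup S) z <-> forall y, S y -> ele y z.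
Proof.
have [ub lub] := esupP S; split=> [le y /ub yS|]; last exact: lub.
exact: ele_trans yS le.
Qed.

(** * The Igusa-Todorov function of a finite set of modules *)

Section PhiDimension.
Variable R : nzRingType.
Hypothesis Rlen : finlen (R^o : lmodType R).
Implicit Types (M N X S : fgmod R) (T : fgmod R -> Prop).

Lemma finlen_finite_dsum T (Y : lmodType R) : finite_dsum T Y -> finlen Y.
Proof.
elim=> [Z Z0|X Z _ _ lenZ]; first by exists 0%N; exact: ranked_zero.
exact: finlen_prod (fgmod_finlen Rlen X) lenZ.
Qed.

Lemma K0span_zero_class T M : zero_module M -> K0span T (K0class M).
Proof.
move=> M0; apply: K0span_eq (K0span_zero T); apply/K0eq_sym/K0eq_proj.
exact: projective_zero.
Qed.

Lemma K0span_prod T M (X Y : fgmod R) : isomorphic M (X * Y)%type ->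
  K0span T (K0class X) -> K0span T (K0class Y) -> K0span T (K0class M).
Proof.
move=> iso sX sY; apply: K0span_eq (K0span_add sX sY).
exact/K0eq_sym/K0eq_dsum.
Qed.

Lemma add_closure_span T M : (forall X, T X -> indecomposable X) ->
  add_closure T M -> K0span T (K0class M).
Proof.
move=> indT [Y [dY]]; elim: dY M => [Z Z0|X Z TX dZ IH] M.
  move=> /dsummandP [s [r sK]]; apply: K0span_zero_class => x.
  by rewrite -[x]sK (Z0 (s x)) linear0.
move=> sumM; have [M' iso] := sumM.
have lenXZ : finlen (X * Z)%type := finlen_prod (fgmod_finlen Rlen X) (finlen_finite_dsum dZ).
have lenX := fgmod_finlen Rlen X.
have lenM' : finlen M'.
  apply: finlen_dsummand lenXZ; apply: dsummand_trans (dsummand_prodr M M') _.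
  exact/dsummand_iso/iso_sym.
have : dsummand X (M * M')%type.
  exact: dsummand_trans (dsummand_prodl X Z) (dsummand_iso iso).
case/(indecomposable_exchange lenX (indT _ TX)) => [[W isoW]|[W isoW]].
  have lenW : finlen W.
    apply: finlen_dsummand (fgmod_finlen Rlen M).
    exact: dsummand_trans (dsummand_prodr X W) (dsummand_iso (iso_sym isoW)).
  apply: (K0span_prod (Y := mkfg lenW) isoW); first exact: K0span_class.
  apply: IH; apply: dsummand_trans (dsummand_prodl W M') _; apply: dsummand_iso.
  apply: (cancellation lenX); apply: iso_trans (iso_prodC _ _) _.
  apply: iso_trans _ (iso_prodC _ _); apply: iso_trans (iso_prodA _ _ _) _.
  by apply: iso_trans _ (iso_sym iso); apply: iso_prod (iso_sym isoW) (iso_refl _).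
apply: IH; apply: dsummand_trans (dsummand_prodl M W) _; apply: dsummand_iso.
apply: (cancellation lenX).
apply: iso_trans (iso_sym (iso_prodA _ _ _)) _.
apply: iso_trans _ (iso_prodC _ _); apply: iso_trans _ (iso_sym iso).
apply: iso_prod (iso_refl _) _.
by apply: iso_trans (iso_prodC _ _) (iso_sym isoW).
Qed.

Lemma span_add_closure T : (forall X, T X -> indecomposable X) ->
  K0span (add_closure T) = K0span T.
Proof.
move=> indT; apply/funext => x; apply/propext; split.
  elim=> {x} [M||x y _ sx _ sy|x _ sx|x y e _ sx].
  - exact: add_closure_span.
  - exact: K0span_zero.
  - exact: K0span_add.
  - exact: K0span_opp.
  - exact: K0span_eq e sx.
elim=> {x} [M TM||x y _ sx _ sy|x _ sx|x y e _ sx].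
- apply: K0span_class; exists (M * zmod R)%type; split; last exact: dsummand_prodl.
  by apply: finite_dsumS => //; apply: finite_dsum0; exact: zmod_zero.
- exact: K0span_zero.
- exact: K0span_add.
- exact: K0span_opp.
- exact: K0span_eq e sx.
Qed.

Lemma finite_span T : finite_up_to_iso T -> exists s : seq (gro Rlen),
  forall x, K0span T x -> zspan s (k0cl Rlen x).
Proof.
move=> [n [r rP]]; exists [seq k0cl Rlen (K0class (r i)) | i <- enum 'I_n] => x.
set s := [seq _ | _ <- _].
elim=> {x} [M TM||x y _ sx _ sy|x _ sx|x y e _ sx].
- have [i iso] := rP _ TM; rewrite (k0cl_sound Rlen (K0eq_iso iso)).
  by apply/zspan_mem/map_f; rewrite mem_enum.
- exact: (zsub_zspan s).1.
- by apply: zsubD => //; exact: zsub_zspan.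
- by apply: zsubN => //; exact: zsub_zspan.
- by rewrite -(k0cl_sound Rlen e).
Qed.

Lemma phi_set_finite T : (forall X, T X -> indecomposable X) ->
  finite_up_to_iso T -> phi_set T <> Infty.
Proof.
move=> indT /finite_span [s sP]; rewrite /phi_set span_add_closure //.
pose N m v := exists x, [/\ K0span T x, k0cl Rlen x = v &
  K0eq (iter m (@K0L R) x) (K0zero R)].
have [|||n nP] := @zspan_noetherian _ s N.
- move=> m; split.
    exists (K0zero R); split=> //; first exact: K0span_zero.
    by rewrite iterK0L0; exact: K0eq_refl.
  move=> _ _ [x [sx <- x0]] [y [sy <- y0]]; exists (K0add x (K0opp y)).
  split=> //; first by apply: K0span_add => //; exact: K0span_opp.
  rewrite iterK0LD iterK0LN; apply/(k0clP Rlen) => /=.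
  by rewrite (k0cl_sound Rlen x0) (k0cl_sound Rlen y0) subrr.
- move=> m _ [x [sx <- x0]]; exists x; split=> //=.
  exact: (K0L_congr Rlen x0).
- by move=> m _ [x [sx <- _]]; exact: sP.
suff le : ele (phi_set T) (Fin n).
  by move=> e; move: le; rewrite /phi_set span_add_closure // e.
rewrite /phi_set span_add_closure //; apply/ninf_leP; exists n => // m nm.
have key x y : K0span T x -> K0span T y ->
    K0eq (iter m.+1 (@K0L R) x) (iter m.+1 (@K0L R) y) ->
    K0eq (iter m (@K0L R) x) (iter m (@K0L R) y).
  move=> sx sy e; pose z := K0add x (K0opp y).
  have sz : K0span T z by apply: K0span_add => //; exact: K0span_opp.
  have Nz : N m.+1 (k0cl Rlen z).
    exists z; split=> //; apply/(k0clP Rlen); rewrite iterK0LD iterK0LN.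
    by rewrite [LHS]/= (k0cl_sound Rlen e) subrr.
  have [|w [sw wz w0]] := nP _ _ _ Nz; first exact: leqW.
  have wm : K0eq (iter m (@K0L R) w) (K0zero R).
    rewrite -(subnK nm) iterD; have := iterK0L_congr Rlen (m - n) w0.
    by rewrite iterK0L0.
  have := iterK0L_congr Rlen m (k0cl_complete wz).
  move=> /(k0cl_sound Rlen); rewrite (k0cl_sound Rlen wm) iterK0LD iterK0LN /=.
  by move=> /esym/eqP; rewrite subr_eq0 => /eqP/k0cl_complete.
exists (@K0L R); split.
- by move=> x [u [su e]]; exists u; split=> //=; exact: (K0L_congr Rlen e).
- by move=> x y _ _; exact: K0eq_refl.
- move=> x y [u [su eu]] [v [sv ev]]; split; last exact: (K0L_congr Rlen).
  move=> e; apply: K0eq_trans (K0eq_sym eu) _; apply: (K0eq_trans _ ev).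
  apply: key => //=; apply: K0eq_trans (K0L_congr Rlen eu) _.
  exact: K0eq_trans e (K0eq_sym (K0L_congr Rlen ev)).
- move=> z [u [su eu]]; exists (iter m (@K0L R) u); split=> //.
  by exists u; split=> //; exact: K0eq_refl.
Qed.

Lemma finite_dsum_prod T (Y Z : lmodType R) : finite_dsum T Y -> finite_dsum T Z ->
  exists2 W, finite_dsum T W & isomorphic (Y * Z)%type W.
Proof.
move=> dY dZ; elim: dY => [Y0 Y00|X Y' TX _ [W dW iso]].
  by exists Z => //; exact: iso_prod0.
exists (X * W)%type; first exact: finite_dsumS.
apply: iso_trans (iso_sym (iso_prodA _ _ _)) _.
exact: iso_prod (iso_refl _) iso.
Qed.

Lemma add_closure_single T : finite_up_to_iso T ->
  exists M, add_closure T = add_closure (fun X => X = M).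
Proof.
move=> [n [r rP]].
have [M [[Y dY isoM] MP]] : exists M, (exists2 Y, finite_dsum T Y & isomorphic M Y) /\
    forall i : 'I_n, i \in enum 'I_n -> forall X, T X -> isomorphic X (r i) -> dsummand X M.
  elim: (enum 'I_n) => [|i l [M [[Y dY iso] MP]]].
    exists (fgzero R); split=> //; exists (fgzero R); last exact: iso_refl.
    by apply: finite_dsum0; exact: zmod_zero.
  have [[X [TX isoX]]|no] := pselect (exists X, T X /\ isomorphic X (r i)).
    exists (fgprod Rlen X M); split.
      exists (X * Y)%type; first exact: finite_dsumS.
      exact: iso_prod (iso_refl _) iso.
    move=> j; rewrite in_cons => /orP [/eqP ->|/MP jP] X' TX' isoX'.
      apply: dsummand_trans (dsummand_prodl X M); apply: dsummand_iso.
      exact: iso_trans isoX' (iso_sym isoX).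
    by apply: dsummand_trans (dsummand_prodr X M); exact: jP.
  exists M; split; first by exists Y.
  move=> j; rewrite in_cons => /orP [/eqP ->|/MP //] X' TX' isoX'.
  by case: no; exists X'.
exists M; apply/funext => X; apply/propext; split=> -[Z [dZ XZ]].
  have [W dW ZW] : exists2 W, finite_dsum (fun X => X = M) W & dsummand Z W.
    elim: dZ {XZ} => [Z' Z0|X' Z' TX' _ [W dW ZW]].
      by exists Z'; [exact: finite_dsum0|exact: dsummand_refl].
    have [i iso] := rP _ TX'; exists (M * W)%type; first exact: finite_dsumS.
    by apply: dsummand_prod => //; apply: (MP i) => //; rewrite mem_enum.
  by exists W; split=> //; exact: dsummand_trans XZ ZW.
have [W dW ZW] : exists2 W, finite_dsum T W & isomorphic Z W.
  elim: dZ {XZ} => [Z' Z0|X' Z' -> _ [W dW ZW]].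
    by exists Z'; [exact: finite_dsum0|exact: iso_refl].
  have [W' dW' isoW'] := finite_dsum_prod dY dW; exists W' => //.
  exact: iso_trans (iso_prod isoM ZW) isoW'.
by exists W; split=> //; exact: dsummand_trans XZ (dsummand_iso ZW).
Qed.

Lemma phi_set_le T : finite_up_to_iso T -> ele (phi_set T) (sup_phi R).
Proof.
move=> /add_closure_single [M e].
have -> : phi_set T = phi M by rewrite /phi /phi_set e.
by apply: (esupP _).1; exists M.
Qed.

(** * Delooping levels of simple modules *)

Lemma Omega_dsummand M N : dsummand M N -> dsummand (Omega M) (Omega N).
Proof.
move=> [M' iso].
have lenM' : finlen M'.
  apply: finlen_dsummand (fgmod_finlen Rlen N).
  exact: dsummand_trans (dsummand_prodr M M') (dsummand_iso (iso_sym iso)).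
exists (Omega (mkfg lenM')); exact: (Omega_prod Rlen (N' := mkfg lenM') iso).
Qed.

Notation T := (@simple_syzygy_summand R).

Lemma simple_syzygy_summand_indecomposable X : T X -> indecomposable X.
Proof. by case=> [/simple_indecomposable|[]]. Qed.

Lemma syzygy_summand_span S n M : simple S -> dsummand M (Omegan n S) ->
  K0span T (K0class M).
Proof.
move=> sS; suff H (Z : lmodType R) : finlen Z -> forall M, isomorphic M Z ->
    dsummand M (Omegan n S) -> K0span T (K0class M).
  exact: H (fgmod_finlen Rlen M) M (iso_refl M).
move: Z; apply: decomposition_ind => [Z Z0|Z lenZ ind|Z A B lenZ iso IHA IHB] {}M isoM.
- by move=> _; apply: K0span_zero_class; exact: iso_zero_module (iso_sym isoM) Z0.
- move=> MO; have [prM|nprM] := pselect (projective M).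
    exact: K0span_eq (K0eq_sym (K0eq_proj prM)) (K0span_zero _).
  apply: K0span_class; right; split=> //; last by exists S, n.
  split=> [M0|A B isoAB]; first by apply: ind.1; exact: iso_zero_module isoM M0.
  by apply: ind.2; exact: iso_trans (iso_sym isoM) isoAB.
- move=> MO; have isoAB := iso_trans isoM iso.
  have lenM := fgmod_finlen Rlen M.
  have sA : dsummand A M := dsummand_trans (dsummand_prodl A B) (dsummand_iso (iso_sym isoAB)).
  have sB : dsummand B M := dsummand_trans (dsummand_prodr A B) (dsummand_iso (iso_sym isoAB)).
  pose A' := mkfg (finlen_dsummand sA lenM); pose B' := mkfg (finlen_dsummand sB lenM).
  apply: (@K0span_prod _ _ A' B' isoAB).
    by apply: (IHA A' (iso_refl _)); exact: dsummand_trans sA MO.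
  by apply: (IHB B' (iso_refl _)); exact: dsummand_trans sB MO.
Qed.

Lemma K0L_span x : K0span T x -> K0span T (K0L x).
Proof.
elim=> {x} /= [M TM||x y _ sx _ sy|x _ sx|x y e _ sx].
- case: TM => [sM|[_ _ [S [n [sS MO]]]]].
    exact: (syzygy_summand_span (n := 1) sM (dsummand_refl _)).
  exact: (syzygy_summand_span (n := n.+1) sS (Omega_dsummand MO)).
- exact: K0span_zero.
- exact: K0span_add.
- exact: K0span_opp.
- exact: K0span_eq (K0L_congr Rlen e) sx.
Qed.

Lemma class_multiple M k : exists W : fgmod R,
  k0cl Rlen (K0class W) = k0cl Rlen (K0class M) *+ k.
Proof.
elim: k => [|k [W WE]].
  by exists (fgzero R); rewrite mulr0n (k0cl_sound Rlen (@K0eq_fgzero R)).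
exists (fgprod Rlen M W).
by rewrite (k0cl_sound Rlen (K0eq_fgprod Rlen M W)) mulrS -WE.
Qed.

Lemma syzygy_multiple_deloop S n (k : int) z : k != 0 ->
  k0cl Rlen (K0class (Omegan n S)) *~ k = k0cl Rlen (iter n.+1 (@K0L R) z) ->
  exists N, dsummand_upto_proj (Omegan n S) (Omegan (n + 1) N).
Proof.
wlog [m ->] : k z / exists m, k = Posz m.+1.
  move=> gen k0 e; case: k k0 e => [[//|m]|m] k0 e.
    by apply: (gen m.+1%:Z z) => //; exists m.
  apply: (gen m.+1%:Z (K0opp z)) => //; first by exists m.
  by rewrite iterK0LN /= -[k0cl _ (K0L _)]e NegzE mulrNz opprK.
move=> _ e; have [N1 [N2 eN]] := K0_diff Rlen z.
have [W WE] := class_multiple (Omegan n S) m.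
have := k0cl_sound Rlen (iterK0L_congr Rlen n.+1 eN).
rewrite iterK0LD !iterK0L_class [LHS]/= -[k0cl _ (K0L _)]/(k0cl Rlen (iter n.+1 (@K0L R) z)).
rewrite -e -pmulrn mulrS -WE -addrA -[gdiff _]/(k0cl Rlen (K0class (Omegan n.+1 N2))).
pose V := fgprod Rlen W (Omegan n.+1 N2).
have -> : k0cl Rlen (K0class W) + k0cl Rlen (K0class (Omegan n.+1 N2)) =
  k0cl Rlen (K0class V) by rewrite (k0cl_sound Rlen (K0eq_fgprod Rlen W _)).
have -> : k0cl Rlen (K0class (Omegan n S)) + k0cl Rlen (K0class V) =
  k0cl Rlen (K0class (fgprod Rlen (Omegan n S) V)).
  by rewrite (k0cl_sound Rlen (K0eq_fgprod Rlen (Omegan n S) V)).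
move=> /k0cl_class_eq [P [Q [prP prQ iso]]].
exists N1, Q; split=> //; rewrite addn1; apply: dsummand_trans (dsummand_iso iso).
apply: dsummand_trans (dsummand_prodl _ P); exact: dsummand_prodl.
Qed.

Lemma dell_le_phi_set S : finite_up_to_iso T -> simple S ->
  ele (dell S) (phi_set T).
Proof.
move=> finT sS; case eT : (phi_set T) => [n|]; last by case: (dell S).
have := ninf_fin eT => /(_ n (leqnn n)) {eT}.
rewrite span_add_closure; last exact: simple_syzygy_summand_indecomposable.
set A := K0Limg n _; set B := K0Limg n.+1 _ => -[f [fAB fD fI _]].
have [s sP] := finite_span finT.
have cls := k0cl_sound Rlen.
have BA x : B x -> A x.
  move=> [u [su e]]; exists (K0L u); split; first exact: K0L_span.
  by rewrite -iterSr.
have Aspan x : A x -> K0span T x.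
  move=> [u [su e]]; apply: K0span_eq e _.
  by elim: (n) => //= m; exact: K0L_span.
pose H v := exists x, A x /\ k0cl Rlen x = v.
have AB x y : A x -> A y -> A (K0add x (K0opp y)).
  move=> [u [su eu]] [v [sv ev]]; exists (K0add u (K0opp v)); split.
    by apply: K0span_add => //; exact: K0span_opp.
  by rewrite iterK0LD iterK0LN; apply: K0eq_add => //; exact: K0eq_opp.
have hH : zsub H.
  split; first exists (K0zero R); [split=> //|].
    by exists (K0zero R); rewrite iterK0L0; split; [exact: K0span_zero|exact: K0eq_refl].
  by move=> _ _ [x [Ax <-]] [y [Ay <-]]; exists (K0add x (K0opp y)); split=> //; exact: AB.
have Hs v : H v -> zspan s v by move=> [x [Ax <-]]; apply/sP/Aspan.
pose phi v := if pselect (H v) is left h then k0cl Rlen (f (projT1 (cid h))) else 0.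
have phiE x : A x -> phi (k0cl Rlen x) = k0cl Rlen (f x).
  move=> Ax; rewrite /phi; case: pselect => [h|[]]; last by exists x.
  case: (cid h) => y [Ay e] /=; apply: cls; apply/fI => //.
  exact: k0cl_complete e.
have phiH v : H v -> H (phi v).
  by move=> [x [Ax <-]]; rewrite phiE //; exists (f x); split=> //; apply/BA/fAB.
have phiD v w : H v -> H w -> phi (v + w) = phi v + phi w.
  move=> [x [Ax <-]] [y [Ay <-]]; rewrite !phiE // -[RHS]/(k0cl Rlen (K0add _ _)).
  rewrite -(cls _ _ (fD _ _ Ax Ay)) -phiE //.
  move: Ax Ay => [u [su eu]] [u' [su' eu']]; exists (K0add u u'); split.
    exact: K0span_add.
  by rewrite iterK0LD; exact: K0eq_add.
have phiB v w : H v -> H w -> phi (v - w) = phi v - phi w.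
  move=> Hv Hw; apply/eqP; rewrite -subr_eq opprK -phiD ?subrK //; exact: hH.2.
have phi0 v : H v -> phi v = 0 -> v = 0.
  move=> Hv e; have H0 := hH.1; have e0 : phi 0 = 0.
    by rewrite -[in LHS](subrr 0) phiB // subrr.
  move: Hv e => [x [Ax <-]] e; have [z [Az z0]] := H0.
  have /k0cl_complete/(fI _ _ Ax Az).1 e1 : k0cl Rlen (f x) = k0cl Rlen (f z).
    by rewrite -!phiE // z0 e e0.
  by rewrite (cls _ _ e1) z0.
have AS : A (K0class (Omegan n S)).
  exists (K0class S); split; first by apply: K0span_class; left.
  by rewrite iterK0L_class; exact: K0eq_refl.
have [|k k0 [_ [x [Ax <-]]]] := torsion_cokernel hH Hs phiH phiB phi0
  (x := k0cl Rlen (K0class (Omegan n S))).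
  by exists (K0class (Omegan n S)).
rewrite phiE // => e; have [z [sz ez]] := fAB _ Ax.
rewrite -(cls _ _ ez) in e.
have [N NP] := syzygy_multiple_deloop k0 e.
by apply/ninf_leP; exists n; [exists N|].
Qed.

End PhiDimension.

(** * Extension of linear maps *)

Section Extension.
Variables (R : nzRingType) (V W : lmodType R).
Implicit Types G A : (V * W)%type -> Prop.

Definition pgraph G := submodule G /\ forall w, G (0, w) -> w = 0.

Lemma pgraph_fun G v w w' : pgraph G -> G (v, w) -> G (v, w') -> w = w'.
Proof.
move=> [hG G0] Gw Gw'; apply/eqP; rewrite -subr_eq0; apply/eqP/G0.
by have := submodB hG Gw Gw'; congr (G (_, _)); exact: subrr.
Qed.

Lemma pgraph_adjoin G v w : pgraph G ->
  (forall a w', G (a *: v, w') -> w' = a *: w) ->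
  pgraph (fun z => exists u y a, [/\ G (u, y), z.1 = u + a *: v & z.2 = y + a *: w]).
Proof.
move=> [hG G0] ext; split; first split.
- exists 0, 0, 0; split; first exact: hG.1.
    by rewrite scale0r addr0.
  by rewrite scale0r addr0.
- move=> k z z' [u [y [a [Gu z1 z2]]]] [u' [y' [a' [Gu' z1' z2']]]].
  exists (k *: u + u'), (k *: y + y'), (k * a + a'); split.
  + exact: (hG.2 k (u, y) (u', y')).
  + by rewrite /= z1 z1' scalerDr scalerDl scalerA addrACA.
  + by rewrite /= z2 z2' scalerDr scalerDl scalerA addrACA.
- move=> x [u [y [a [Gu /= e ->]]]].
  have uE : u = (- a) *: v by apply/eqP; rewrite scaleNr -addr_eq0 -e.
  by rewrite uE in Gu; rewrite (ext _ _ Gu) scaleNr addNr.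
Qed.

Lemma linear_extension (G0 : (V * W)%type -> Prop) : pgraph G0 ->
  (forall G, pgraph G -> (forall z, G0 z -> G z) ->
     forall v, exists w, forall a w', G (a *: v, w') -> w' = a *: w) ->
  exists f : {linear V -> W}, forall v w, G0 (v, w) -> f v = w.
Proof.
move=> pG0 ext; pose U A z := G0 z \/ A z.
have [F FP Ftot|A [PA Amax]] := @Zorn_bigcup _ (fun A => pgraph (U A)).
  have both z z' : U (\bigcup_(X in F) X)%classic z ->
      U (\bigcup_(X in F) X)%classic z' ->
    exists B, [/\ pgraph (U B), U B z, U B z' &
      forall y, U B y -> U (\bigcup_(X in F) X)%classic y].
    have up X y : F X -> U X y -> U (\bigcup_(X in F) X)%classic y.
      by move=> FX [G0y|Xy]; [left|right; exists X].
    move=> [z0|[X FX Xz]] [z0'|[Y FY Yz']].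
    - exists (fun=> False); split; try by left.
        suff -> : U (fun=> False) = G0 by [].
        by apply/funext => y; apply/propext; split=> [[]|] //; left.
      by move=> y [|//]; left.
    - by exists Y; split; [exact: FP|left|right|move=> y; exact: up].
    - by exists X; split; [exact: FP|right|left|move=> y; exact: up].
    - case: (Ftot _ _ FX FY) => [XY|YX].
        by exists Y; split; [exact: FP|right; exact: XY|right|move=> y; exact: up].
      by exists X; split; [exact: FP|right|right; exact: YX|move=> y; exact: up].
  split; first split.
  - by left; exact: pG0.1.1.
  - move=> a z z' Uz Uz'; have [B [pB Bz Bz' sub]] := both _ _ Uz Uz'.
    by apply: sub; exact: pB.1.2.
  - move=> w Uw; have [B [pB Bz _ _]] := both _ _ Uw Uw.
    exact: pB.2 Bz.
have dom v : exists w, U A (v, w).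
  apply: contrapT => no.
  have [|w wP] := ext _ PA _ v; first by left.
  pose G' z := exists u y a, [/\ U A (u, y), z.1 = u + a *: v & z.2 = y + a *: w].
  have UG' z : U A z -> G' z.
    by case: z => u y Uz; exists u, y, 0; rewrite !scale0r !addr0.
  have vG' : G' (v, w).
    exists 0, 0, 1; rewrite !scale1r !add0r; split=> //; exact: PA.1.1.
  apply: (Amax G').
    split=> [z Az|sub]; first by apply: UG'; right.
    by apply: no; exists w; right; exact: sub.
  suff -> : U G' = G' by exact: pgraph_adjoin.
  apply/funext => z; apply/propext; split=> [[G0z|//]|]; last by right.
  by apply: UG'; left.
pose f v := projT1 (cid (dom v)).
have fP v : U A (v, f v) := projT2 (cid (dom v)).
have lf : linear f.
  move=> a x y; apply: (pgraph_fun PA (fP _)).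
  exact: (PA.1.2 a (x, f x) (y, f y) (fP x) (fP y)).
by exists (linmap lf) => v w Gw; apply: (pgraph_fun PA (fP v)); left.
Qed.

End Extension.

Section Functionals.
Variables (K : fieldType) (V : zmodType) (sc : K -> V -> V).
Hypotheses (scA : forall a b x, sc a (sc b x) = sc (a * b) x)
  (sc1 : left_id 1 sc) (scDr : right_distributive sc +%R)
  (scDl : forall x, {morph sc^~ x : a b / a + b}).

Definition kfunctional (f : V -> K) := forall k x y, f (sc k x + y) = k * f x + f y.

Definition kspace_of (_ : forall a b x, sc a (sc b x) = sc (a * b) x)
  (_ : left_id 1 sc) (_ : right_distributive sc +%R)
  (_ : forall x, {morph sc^~ x : a b / a + b}) : Type := V.
Notation E := (kspace_of scA sc1 scDr scDl).
HB.instance Definition _ := GRing.Zmodule.on E.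
HB.instance Definition _ := GRing.Zmodule_isLmodule.Build K E scA sc1 scDr scDl.

Lemma functional_extension (G : V -> K -> Prop) :
  G 0 0 -> (forall k x y a b, G x a -> G y b -> G (sc k x + y) (k * a + b)) ->
  (forall a, G 0 a -> a = 0) ->
  exists f, kfunctional f /\ forall x a, G x a -> f x = a.
Proof.
move=> G00 Glin G0.
have pG : @pgraph K E K^o (fun z => G z.1 z.2).
  by split; [split=> // k [x a] [y b]; exact: Glin|].
have [|f fP] := linear_extension pG.
  move=> H pH GH v.
  have [[w Hw]|no] := pselect (exists w, H (v, w)).
    exists w => a w' Hw'; apply: (pgraph_fun pH Hw').
    exact: (submodZ pH.1 a Hw).
  exists 0 => a w' Hw'; have [a0|an0] := eqVneq a 0.
    by move: Hw'; rewrite a0 !scale0r => /pH.2.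
  case: no; exists (a^-1 *: w'); have := submodZ pH.1 a^-1 Hw'.
  by congr (H (_, _)); rewrite /= scalerA mulVf // scale1r.
by exists f; split=> [k x y|x a Gx]; [exact: linearP|exact: fP].
Qed.

End Functionals.

(** * Balanced forms *)

Record antipair (K : fieldType) (R R' : nzRingType) := Antipair {
  anti :> R -> R';
  scal : {rmorphism K -> R'};
  antiD : {morph anti : x y / x + y};
  antiM : forall x y, anti (x * y) = anti y * anti x;
  anti1 : anti 1 = 1;
  scal_comm : forall k x, scal k * anti x = anti x * scal k
}.

Section Dual.
Variables (K : fieldType) (R R' : nzRingType) (o : antipair K R R').

Definition kscale (M : lmodType R') (k : K) (m : M) : M := scal o k *: m.

Lemma kscaleA (M : lmodType R') k l (m : M) :
  kscale k (kscale l m) = kscale (k * l) m.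
Proof. by rewrite /kscale scalerA -rmorphM. Qed.

Lemma kscale1 (M : lmodType R') : left_id 1 (@kscale M).
Proof. by move=> m; rewrite /kscale rmorph1 scale1r. Qed.

Lemma kscaleDr (M : lmodType R') : right_distributive (@kscale M) +%R.
Proof. by move=> k m m'; rewrite /kscale scalerDr. Qed.

Lemma kscaleDl (M : lmodType R') (m : M) : {morph (@kscale M)^~ m : k l / k + l}.
Proof. by move=> k l; rewrite /kscale rmorphD scalerDl. Qed.

Lemma kfunctionalD (M : lmodType R') (f : M -> K) : kfunctional (@kscale M) f ->
  {morph f : x y / x + y}.
Proof. by move=> lf x y; rewrite -{1}(kscale1 x) lf mul1r. Qed.

Lemma kfunctional0 (M : lmodType R') (f : M -> K) : kfunctional (@kscale M) f ->
  f 0 = 0.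
Proof. by move=> lf; apply: (addIr (f 0)); rewrite -kfunctionalD // !add0r. Qed.

Lemma kfunctionalZ (M : lmodType R') (f : M -> K) : kfunctional (@kscale M) f ->
  forall k x, f (kscale k x) = k * f x.
Proof. by move=> lf k x; rewrite -[kscale k x]addr0 lf kfunctional0 // addr0. Qed.

Lemma kfunctional_anti (M : lmodType R') (f : M -> K) r :
  kfunctional (@kscale M) f -> kfunctional (@kscale M) (fun m => f (o r *: m)).
Proof.
move=> lf k x y; rewrite scalerDr /kscale scalerA -scal_comm -scalerA.
exact: lf.
Qed.

Section DualType.
Variable M : lmodType R'.

Definition dual := {f : M -> K | `[< kfunctional (@kscale M) f >]}.
HB.instance Definition _ := SubType.on dual.
HB.instance Definition _ := [Choice of dual by <:].

Lemma dualP (f : dual) : kfunctional (@kscale M) (val f).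
Proof. exact/asboolP/(valP f). Qed.

Definition mkdual (f : M -> K) (lf : kfunctional (@kscale M) f) : dual :=
  exist _ f (introT (asboolP _) lf).

Lemma dual_zero_subproof : kfunctional (@kscale M) (fun=> 0).
Proof. by move=> k x y; rewrite mulr0 addr0. Qed.
Lemma dual_opp_subproof (f : dual) : kfunctional (@kscale M) (fun m => - val f m).
Proof. by move=> k x y; rewrite (dualP f) opprD mulrN. Qed.
Lemma dual_add_subproof (f g : dual) :
  kfunctional (@kscale M) (fun m => val f m + val g m).
Proof. by move=> k x y; rewrite (dualP f) (dualP g) mulrDr addrACA. Qed.

Definition dual_zero := mkdual dual_zero_subproof.
Definition dual_opp f := mkdual (dual_opp_subproof f).
Definition dual_add f g := mkdual (dual_add_subproof f g).
Definition dual_scale r (f : dual) := mkdual (kfunctional_anti r (dualP f)).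

Lemma dual_addA : associative dual_add.
Proof. by move=> f g h; apply: val_inj; apply/funext => m /=; rewrite addrA. Qed.
Lemma dual_addC : commutative dual_add.
Proof. by move=> f g; apply: val_inj; apply/funext => m /=; rewrite addrC. Qed.
Lemma dual_add0 : left_id dual_zero dual_add.
Proof. by move=> f; apply: val_inj; apply/funext => m /=; rewrite add0r. Qed.
Lemma dual_addN : left_inverse dual_zero dual_opp dual_add.
Proof. by move=> f; apply: val_inj; apply/funext => m /=; rewrite addNr. Qed.

HB.instance Definition _ :=
  GRing.isZmodule.Build dual dual_addA dual_addC dual_add0 dual_addN.

Lemma dual_scaleA r t f : dual_scale r (dual_scale t f) = dual_scale (r * t) f.
Proof.
by apply: val_inj; apply/funext => m /=; rewrite scalerA antiM.
Qed.
Lemma dual_scale1 : left_id 1 dual_scale.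
Proof.
by move=> f; apply: val_inj; apply/funext => m /=; rewrite anti1 scale1r.
Qed.
Lemma dual_scaleDr : right_distributive dual_scale +%R.
Proof. by move=> r f g; apply: val_inj. Qed.
Lemma dual_scaleDl f : {morph dual_scale^~ f : r t / r + t}.
Proof.
move=> r t; apply: val_inj; apply/funext => m /=.
by rewrite antiD scalerDl (kfunctionalD (dualP f)).
Qed.

HB.instance Definition _ := GRing.Zmodule_isLmodule.Build R dual
  dual_scaleA dual_scale1 dual_scaleDr dual_scaleDl.

End DualType.

Definition balanced (M : lmodType R') (F : lmodType R) (b : M -> F -> K) : Prop :=
  [/\ forall x, kfunctional (@kscale M) (b^~ x),
      forall m, {morph b m : x y / x + y}
    & forall r m x, b (o r *: m) x = b m (r *: x)].

(* Forms balanced on [M * F] are linear maps from [F] to the dual of [M], and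
   restriction of functionals to a submodule is onto. *)
Lemma balanced_extension (M' M : lmodType R') (i : {linear M' -> M})
    (F : lmodType R) (b' : M' -> F -> K) :
  injective i -> projective F -> balanced b' ->
  exists b : M -> F -> K, balanced b /\ forall m x, b (i m) x = b' m x.
Proof.
move=> ii prF [bl bD ba].
have res_fun (f : dual M) : kfunctional (@kscale M') (fun m => val f (i m)).
  move=> k x y; rewrite linearD /kscale linearZ /=.
  exact: (dualP f k (i x) (i y)).
have res_lin : linear (fun f : dual M => mkdual (res_fun f)).
  by move=> r f g; apply: val_inj; apply/funext => m /=; rewrite linearZ.
have res_surj : surj (linmap res_lin).
  move=> g; pose G x a := exists m, i m = x /\ val g m = a.
  have [|||f [lf fG]] := @functional_extension K M (@kscale M) (@kscaleA M)
     (@kscale1 M) (@kscaleDr M) (@kscaleDl M) G.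
  - by exists 0; rewrite linear0 (kfunctional0 (dualP g)).
  - move=> k _ _ _ _ [m [<- <-]] [m' [<- <-]]; exists (kscale k m + m').
    by rewrite linearD /kscale linearZ; split=> //; exact: (dualP g).
  - move=> a [m [/eqP m0 <-]]; rewrite -(linear0 i) in m0; move/eqP/ii: m0 => ->.
    exact: kfunctional0 (dualP g).
  exists (mkdual lf); apply: val_inj; apply/funext => m /=.
  by apply: fG; exists m.
have b_lin : linear (fun x => mkdual (bl x)).
  move=> r x y; apply: val_inj; apply/funext => m /=.
  by rewrite bD ba.
have [h hE] := prF _ _ _ (linmap b_lin) res_surj.
exists (fun m x => val (h x) m); split; last first.
  by move=> m x; have /(congr1 val)/(congr1 (fun f => f m)) := hE x.
split=> [x|m x y|r m x].
- exact: dualP.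
- by rewrite linearD.
- by rewrite linearZ.
Qed.

End Dual.

Section Resolutions.
Variable R : nzRingType.
Implicit Types (X : lmodType R) (C : nat -> lmodType R).

Lemma resolution_zero C X : left_resolution 0 C X -> isomorphic (C 0%N) X.
Proof.
move=> [e [d [es ed dd C0]]]; exists e; split=> //; apply: injective_ker0 => x.
by move=> /ed [y <-]; rewrite (C0 1%N isT y) linear0.
Qed.

Definition resolves n C X (e : {linear C 0%N -> X})
    (d : forall i, {linear C i.+1 -> C i}) : Prop :=
  [/\ surj e, exact_at (d 0%N) e, forall i, exact_at (d i.+1) (d i)
    & forall i, (n < i)%N -> zero_module (C i)].

Lemma resolves_tail n C X (e : {linear C 0%N -> X})
    (d : forall i, {linear C i.+1 -> C i}) : resolves n.+1 e d ->
  exists e' : {linear C 1%N -> kerm e},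
    resolves (C := fun i => C i.+1) n e' (fun i => d i.+1).
Proof.
move=> [es ed dd C0].
have ker x : e (d 0%N x) = 0 by apply/ed; exists x.
exists (tosubm (submodule_ker e) ker); split.
- move=> y; have /ed [x xE] := subm_prop y; exists x; exact: val_inj.
- move=> y; rewrite -(dd 0%N y); split=> [/(congr1 val) //|e0]; exact: val_inj.
- by move=> i; exact: dd.
- by move=> i ni; apply: C0.
Qed.

Lemma resolution_tail n C X : left_resolution n.+1 C X ->
  exists2 e : {linear C 0%N -> X}, surj e &
    left_resolution n (fun i => C i.+1) (kerm e).
Proof.
move=> [e [d res]]; exists e; first by case: res.
by have [e' res'] := resolves_tail res; exists e', (fun i => d i.+1).
Qed.

Lemma resolution_cons n C X (P : lmodType R) (e : {linear P -> X}) : surj e ->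
  left_resolution n C (kerm e) ->
  left_resolution n.+1 (fun i => if i is i'.+1 then C i' else P) X.
Proof.
move=> es [e' [d [es' ed dd C0]]].
pose C' i := if i is i'.+1 then C i' else P.
pose d' i : {linear C' i.+1 -> C' i} :=
  match i return {linear C' i.+1 -> C' i} with
  | 0%N => lcomp (submval (submodule_ker e)) e'
  | i'.+1 => d i'
  end.
exists e, d'; split=> //.
- move=> y; split=> [ey|[x <-]]; last exact: (subm_prop (e' x)).
  by have [x xE] := es' (mksubm (submodule_ker e) ey); exists x; rewrite /= xE.
- case=> [|i]; last exact: dd.
  move=> y; rewrite -(ed y); split=> [e0|/= -> //]; exact: val_inj.
- by case=> // i; exact: C0.
Qed.

Lemma resolution_projective X : projective X ->
  exists C, left_resolution 0 C X /\ forall i, projective (C i).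
Proof.
move=> prX; exists (fun i => if i is 0 then X else zmod R); split; last first.
  by case=> [//|i]; apply: projective_zero; exact: zmod_zero.
exists (lid X), (fun i => lzero _ _); split=> [x|x|i x|[//|i _]]; last exact: zmod_zero.
- by exists x.
- by split=> [x0|[y <-]] //; exists 0; exact: esym x0.
- by split=> [_|[y <-]] //; exists 0; rewrite (zmod_zero x).
Qed.

Lemma linear_descend (M N L : lmodType R) (p : {linear M -> N}) (f : {linear M -> L}) :
  surj p -> (forall x, p x = 0 -> f x = 0) ->
  exists g : {linear N -> L}, forall x, g (p x) = f x.
Proof.
move=> ps f0; pose t y := projT1 (cid (ps y)).
have tE y : p (t y) = y := projT2 (cid (ps y)).
have gE x : f (t (p x)) = f x.
  by apply/eqP; rewrite -subr_eq0 -linearB f0 // linearB /= tE subrr.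
have lg : linear (fun y => f (t y)).
  by move=> a y z; rewrite -{1}[y]tE -{1}[z]tE -linearP gE linearP.
by exists (linmap lg).
Qed.

Lemma resolution_shorten n C X (e : {linear C 0%N -> X})
    (d : forall i, {linear C i.+1 -> C i}) (g : {linear C n -> C n.+1}) :
  resolves n.+1 e d -> (forall i, projective (C i)) -> cancel (d n) g ->
  exists C', left_resolution n C' X /\ forall i, projective (C' i).
Proof.
elim: n C X e d g => [|n IH] C X e d g res prC dK.
  have [es ed _ _] := res; apply: resolution_projective.
  pose q := lsub (lid (C 0%N)) (lcomp (d 0%N) g).
  have [|s sE] := linear_descend (f := q) es.
    by move=> x /ed [y <-] /=; rewrite dK subrr.
  apply: projective_dsummand (prC 0%N); apply/dsummandP; exists s, e => x.
  have [y <-] := es x; rewrite sE /= linearB /=.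
  have -> : e (d 0%N (g y)) = 0 by apply/ed; exists (g y).
  by rewrite subr0.
have [e' res'] := resolves_tail res.
have [C' [resC' prC']] := IH _ _ _ _ g res' (fun i => @prC i.+1) dK.
exists (fun i => if i is i'.+1 then C' i' else C 0%N); split; last first.
  by case=> [|i]; [exact: prC|exact: prC'].
by apply: resolution_cons resC'; case: res.
Qed.

End Resolutions.

Section BalancedOperations.
Variables (K : fieldType) (R R' : nzRingType) (o : antipair K R R').

Lemma balanced_precomp (M N : lmodType R') (F : lmodType R) (f : {linear N -> M})
  (b : M -> F -> K) : balanced o b -> balanced o (fun m => b (f m)).
Proof.
move=> [bl bD ba]; split=> [x k m m'|m|r m x].
- by rewrite linearD /kscale linearZ; exact: bl.
- exact: bD.
- by rewrite linearZ ba.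
Qed.

Lemma balanced_postcomp (M : lmodType R') (F G : lmodType R) (g : {linear G -> F})
  (b : M -> F -> K) : balanced o b -> balanced o (fun m x => b m (g x)).
Proof.
move=> [bl bD ba]; split=> [x|m x y|r m x]; first exact: bl.
- by rewrite linearD bD.
- by rewrite ba -linearZ.
Qed.

Lemma balanced_sub (M : lmodType R') (F : lmodType R) (b c : M -> F -> K) :
  balanced o b -> balanced o c -> balanced o (fun m x => b m x - c m x).
Proof.
move=> [bl bD ba] [cl cD ca]; split=> [x k m m'|m x y|r m x].
- by rewrite bl cl mulrBr opprD addrACA.
- by rewrite bD cD opprD addrACA.
- by rewrite ba ca.
Qed.

Lemma balanced_add (M : lmodType R') (F : lmodType R) (b c : M -> F -> K) :
  balanced o b -> balanced o c -> balanced o (fun m x => b m x + c m x).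
Proof.
move=> [bl bD ba] [cl cD ca]; split=> [x k m m'|m x y|r m x].
- by rewrite bl cl mulrDr addrACA.
- by rewrite bD cD addrACA.
- by rewrite ba ca.
Qed.

Lemma balanced0 (M : lmodType R') (F : lmodType R) :
  balanced o (fun (_ : M) (_ : F) => 0).
Proof. by split=> [x k m m'|m x y|r m x]; rewrite ?mulr0 ?addr0. Qed.

Lemma balanced_addl (M : lmodType R') (F : lmodType R) (b : M -> F -> K) m m' x :
  balanced o b -> b (m + m') x = b m x + b m' x.
Proof. by case=> bl _ _; rewrite (kfunctionalD (bl x)). Qed.

Lemma balanced_subl (M : lmodType R') (F : lmodType R) (b : M -> F -> K) m m' x :
  balanced o b -> b (m - m') x = b m x - b m' x.
Proof.
by move=> hb; apply/eqP; rewrite eq_sym subr_eq -balanced_addl // subrK.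
Qed.

Lemma balanced_subr (M : lmodType R') (F : lmodType R) (b : M -> F -> K) m x x' :
  balanced o b -> b m (x - x') = b m x - b m x'.
Proof.
by case=> _ bD _; apply/eqP; rewrite eq_sym subr_eq -bD subrK.
Qed.

Lemma balanced_zerol (M : lmodType R') (F : lmodType R) (b : M -> F -> K) x :
  balanced o b -> b 0 x = 0.
Proof. by move=> hb; rewrite -(subrr 0) balanced_subl // subrr. Qed.

Lemma balanced_zeror (M : lmodType R') (F : lmodType R) (b : M -> F -> K) m :
  balanced o b -> b m 0 = 0.
Proof. by move=> hb; rewrite -(subrr 0) balanced_subr // subrr. Qed.

Lemma balanced_descend (M Q : lmodType R') (F : lmodType R) (p : {linear M -> Q})
    (b : M -> F -> K) : surj p -> balanced o b ->
  (forall m x, p m = 0 -> b m x = 0) ->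
  exists2 c : Q -> F -> K, balanced o c & forall m x, c (p m) x = b m x.
Proof.
move=> ps hb b0; pose t q := projT1 (cid (ps q)).
have tE q : p (t q) = q := projT2 (cid (ps q)).
have cE m x : b (t (p m)) x = b m x.
  apply/eqP; rewrite -subr_eq0 -balanced_subl // b0 //.
  by rewrite linearB /= tE subrr.
exists (fun q => b (t q)) => //; have [bl bD ba] := hb.
split=> [x k q q'|q|r q x]; last 1 first.
- by rewrite -[q in LHS]tE -linearZ cE ba.
- by rewrite -[q in LHS]tE -[q' in LHS]tE /kscale -linearZ -linearD cE; exact: bl.
- exact: bD.
Qed.

End BalancedOperations.

Section Transpose.
Variables (K : fieldType) (R R' : nzRingType).
Variables (o : antipair K R R') (o' : antipair K R' R).

Definition compatible := (forall k, o (scal o' k) = scal o k) /\ cancel o' o.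

Lemma balanced_transpose (M : lmodType R') (F : lmodType R) (b : M -> F -> K) :
  compatible -> balanced o b -> balanced o' (fun x m => b m x).
Proof.
move=> [ks os] [bl bD ba]; split=> [m k x y|x|r m x].
- by rewrite bD -ba ks (kfunctionalZ (bl x)).
- exact: kfunctionalD (bl x).
- by rewrite -ba os.
Qed.

End Transpose.

(** * Vanishing of Ext against dual modules *)

Section ExtVanishing.
Variables (K : fieldType) (R R' : nzRingType).
Variables (o : antipair K R R') (o' : antipair K R' R).
Hypotheses (oo' : compatible o o') (o'o : compatible o' o).
Variables (C : nat -> lmodType R) (d : forall i, {linear C i.+1 -> C i}).
Hypotheses (exd : forall i, exact_at (d i.+1) (d i)).
Hypotheses (prC : forall i, projective (C i)).
Implicit Types M N P Q : lmodType R'.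

(* Expresses Ext^(j+1)(X, DM) = 0, equivalently Tor_(j+1)(M, X) = 0, when [C] is
   a projective resolution of X. *)
Definition ext0 j M : Prop := forall b : M -> C j.+1 -> K, balanced o b ->
  (forall m x, b m (d j.+1 x) = 0) ->
  exists2 c : M -> C j -> K, balanced o c & forall m x, b m x = c m (d j x).

Lemma ext0_dsummand j M N : dsummand M N -> ext0 j N -> ext0 j M.
Proof.
move=> /dsummandP [s [r sK]] eN b hb b0.
have [|c hc cE] := eN _ (balanced_precomp r hb); first by move=> m x; exact: b0.
exists (fun m => c (s m)); first exact: balanced_precomp.
by move=> m x; rewrite -cE sK.
Qed.

Lemma ext0_top j M : zero_module (C j.+1) -> ext0 j M.
Proof.
move=> C0 b hb _; exists (fun _ _ => 0); first exact: balanced0.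
by move=> m x; rewrite (C0 x) (balanced_zeror _ hb).
Qed.

Lemma ext0_projective j P : projective P -> ext0 j P.
Proof.
move=> prP b hb b0; pose Im := imgm (d j).
have ker m x : d j x = 0 -> b m x = 0 by move=> /exd [y <-]; exact: b0.
pose q : {linear C j.+1 -> Im} :=
  tosubm (submodule_range (d j)) (f := d j) (fun x => ex_intro _ x erefl).
have qs : surj q.
  by move=> y; have [x xE] := subm_prop y; exists x; apply: val_inj.
have [|c hc cE] := balanced_descend qs (balanced_transpose oo' hb).
  by move=> x m /(congr1 val) /= /ker ->.
have [c' [hc' c'E]] := balanced_extension
  (@submval_inj _ _ _ (submodule_range (d j))) prP hc.
exists (fun m x => c' x m); first exact: balanced_transpose o'o hc'.
by move=> m x; rewrite -(cE x m) -c'E.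
Qed.

Section ShortExact.
Variables (M' M M'' : lmodType R') (i : {linear M' -> M}) (p : {linear M -> M''}).
Hypotheses (ii : injective i) (ps : surj p) (ip : exact_at i p).

Lemma ext0_sub j : ext0 j.+1 M'' -> ext0 j M -> ext0 j M'.
Proof.
move=> e2 e1 b hb b0.
have [bt [hbt btE]] := balanced_extension ii (@prC j.+1) hb.
have [|b2 hb2 b2E] := balanced_descend ps (balanced_postcomp (d j.+1) hbt).
  by move=> m x /ip [m' <-]; rewrite btE b0.
have [|c2 hc2 c2E] := e2 _ hb2.
  move=> m x; have [m1 <-] := ps m; rewrite b2E.
  have -> : d j.+1 (d j.+2 x) = 0 by apply/exd; exists x.
  exact: balanced_zeror hbt.
have hs := balanced_sub hbt (balanced_precomp p hc2).
have [|c hc cE] := e1 _ hs.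
  by move=> m x; rewrite -c2E b2E subrr.
exists (fun m => c (i m)); first exact: balanced_precomp.
move=> m x; rewrite -cE btE.
have -> : p (i m) = 0 by apply/ip; exists m.
by rewrite (balanced_zerol _ hc2) subr0.
Qed.

Lemma ext0_quo j : ext0 j.+1 M -> ext0 j M' -> ext0 j.+1 M''.
Proof.
move=> e2 e1 b hb b0.
have [|c hc cE] := e2 _ (balanced_precomp p hb); first by move=> m x; exact: b0.
have [|c' hc' c'E] := e1 _ (balanced_precomp i hc).
  move=> m x; rewrite -cE; have -> : p (i m) = 0 by apply/ip; exists m.
  exact: balanced_zerol hb.
have [ct [hct ctE]] := balanced_extension ii (@prC j) hc'.
have hs := balanced_sub hc (balanced_postcomp (d j) hct).
have [|c2 hc2 c2E] := balanced_descend ps hs.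
  by move=> m x /ip [m' <-]; rewrite ctE -c'E subrr.
exists c2 => // m x; have [m1 <-] := ps m; rewrite c2E cE.
have -> : d j (d j.+1 x) = 0 by apply/exd; exists x.
by rewrite (balanced_zeror _ hct) subr0.
Qed.

Lemma ext0_extension j : ext0 j M' -> ext0 j M'' -> ext0 j M.
Proof.
move=> e1 e2 b hb b0.
have [|c' hc' c'E] := e1 _ (balanced_precomp i hb); first by move=> m x; exact: b0.
have [ct [hct ctE]] := balanced_extension ii (@prC j) hc'.
have hs := balanced_sub hb (balanced_postcomp (d j) hct).
have [|b2 hb2 b2E] := balanced_descend ps hs.
  by move=> m x /ip [m' <-]; rewrite ctE -c'E subrr.
have [|c2 hc2 c2E] := e2 _ hb2.
  move=> m x; have [m1 <-] := ps m; rewrite b2E b0.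
  have -> : d j (d j.+1 x) = 0 by apply/exd; exists x.
  by rewrite (balanced_zeror _ hct) subr0.
exists (fun m x => ct m x + c2 (p m) x).
  by apply: balanced_add => //; exact: balanced_precomp.
by move=> m x; rewrite -c2E b2E addrCA subrr addr0.
Qed.

End ShortExact.

Lemma ext0_prod j M N : ext0 j M -> ext0 j N -> ext0 j (M * N)%type.
Proof.
apply: (ext0_extension (i := linl M N) (p := lsnd M N)).
- by move=> x y [].
- by move=> y; exists (0, y).
- move=> [x y]; split=> [/= ->|[z [<- <-]] //]; by exists x.
Qed.

Lemma ext0_syzygy j X M : is_syzygy X M -> ext0 j.+1 M <-> ext0 j X.
Proof.
move=> [P [p [i [[prP ps _] ii ip]]]]; split=> e.
  exact: (ext0_sub ii ps ip e (@ext0_projective j P prP)).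
exact: (ext0_quo ii ps ip (@ext0_projective j.+1 P prP) e).
Qed.

Lemma ext0_upto_proj j M N : dsummand_upto_proj M N -> ext0 j N -> ext0 j M.
Proof.
move=> [P [prP sM]] eN; apply: ext0_dsummand sM _.
by apply: ext0_prod => //; exact: ext0_projective.
Qed.

Lemma ext0_resolution n j (D : nat -> lmodType R') M : left_resolution n D M ->
  (n <= j)%N -> (forall i, (i <= n)%N -> ext0 (j - i) (D i)) -> ext0 j M.
Proof.
elim: n j D M => [|n IH] j D M.
  move=> /resolution_zero iso _ /(_ 0%N isT); rewrite subn0.
  exact: ext0_dsummand (dsummand_iso (iso_sym iso)).
move=> /resolution_tail [e es res]; case: j => // j nj eD.
apply: (ext0_quo (@submval_inj _ _ _ (submodule_ker e)) es (exact_kerm e)).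
  exact: (eD 0%N isT).
by apply: IH res nj _ => i im; exact: (eD i.+1).
Qed.

Section Deloop.
Hypothesis R'len : finlen (R'^o : lmodType R').

Lemma ext0_Omegan n j (M : fgmod R') : ext0 (j + n) M <-> ext0 j (Omegan n M).
Proof.
elim: n j => [|n IH] j; first by rewrite addn0.
rewrite addnS -addSn IH /=; exact/ext0_syzygy/OmegaP.
Qed.

Variable top : nat.
Hypothesis C0 : forall i, (top < i)%N -> zero_module (C i).

Lemma ext0_kdell k m (M : fgmod R') j : ele (kdell k M) (Fin m) ->
  (m <= j)%N -> (top <= j + k)%N -> ext0 j M.
Proof.
move=> /ninf_leP [n [N sN] nm] mj tj; have nj := leq_trans nm mj.
rewrite -(subnK nj); apply/ext0_Omegan; apply: ext0_upto_proj sN _.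
apply/ext0_Omegan; rewrite addnA subnK //; apply: ext0_top; apply: C0.
by rewrite ltnS.
Qed.

Lemma ext0_sub_ddell m (M : fgmod R') : ele (sub_ddell M) (Fin m) ->
  (m < top)%N -> ext0 top.-1 M.
Proof.
move=> /einf_leP [_ [N [[f fi] ->]] dN] mt.
have top0 : (0 < top)%N by exact: leq_trans mt.
have eN : ext0 top.-1 N by apply: ext0_kdell dN _ _; lia.
pose p := toquo (submodule_range f).
have ex : exact_at f p by move=> y; exact: toquo_ker.
apply: (ext0_sub fi (@toquo_surj _ _ _ (submodule_range f)) ex) eN.
by apply/ext0_top/C0; rewrite prednK.
Qed.

Lemma ext0_ddell m (M : fgmod R') : ele (ddell M) (Fin m) ->
  (m < top)%N -> ext0 top.-1 M.
Proof.
move=> /ninf_leP [m' [n [D [nm res dD]]] m'm] mt.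
have {m'm}mt : (m' < top)%N by exact: leq_ltn_trans mt.
apply: (ext0_resolution res) => [|i im]; first by lia.
by apply: ext0_kdell (dD i im) _ _; lia.
Qed.

End Deloop.
End ExtVanishing.

(** * The radical *)

Section Radical.
Variable R : nzRingType.

Lemma maximal_submodule (M : lmodType R) (N : M -> Prop) : finlen M -> submodule N ->
  (exists2 x, N x & x <> 0) ->
  exists U, [/\ submodule U, forall x, U x -> N x, exists2 x, N x & ~ U x &
    forall x, N x -> ~ U x -> forall y, N y -> exists u c, U u /\ y = u + c *: x].
Proof.
move=> [n [rho [b s]]] hN [x0 Nx0 x0n].
pose P U := [/\ submodule U, forall x, U x -> N x & exists2 x, N x & ~ U x].
pose Q k := `[< exists2 U, P U & rho U = k >].
have exQ : exists k, Q k.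
  exists (rho (fun x => x = 0)); apply/asboolP; exists (fun x => x = 0) => //.
  split; [exact: submodule_zero|move=> x ->; exact: hN.1|by exists x0].
have bQ k : Q k -> (k <= n)%N by move=> /asboolP [U [hU _ _] <-]; exact: b.
case: (ex_maxnP exQ bQ) => k /asboolP [U [hU UN nU] Uk] kmax.
exists U; split=> // x Nx nUx y Ny; apply: contrapT => no.
pose U' y := exists u v, [/\ U u, exists c, c *: x = v & y = u + v].
have hU' : submodule U' by apply: submodule_sum => //; exact: submodule_range (lelt x).
have UU' z : U z -> U' z.
  by move=> Uz; exists z, 0; split; rewrite ?addr0 //; exists 0; rewrite scale0r.
have [_ eq] := s _ _ hU hU' UU'.
apply: nUx; apply: eq; last first.
  by exists 0, x; split; rewrite ?add0r //; [exact: hU.1|exists 1; rewrite scale1r].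
rewrite Uk; apply: kmax; apply/asboolP; exists U' => //; split=> //.
  by move=> _ [u [_ [Uu [c <-] ->]]]; apply: submodD => //; [exact: UN|exact: submodZ].
by exists y => // -[u [_ [Uu [c <-] e]]]; apply: no; exists u, c.
Qed.

Definition maximal_ideal (m : R -> Prop) : Prop :=
  [/\ submodule (m : (R^o : lmodType R) -> Prop), ~ m 1
    & forall a, ~ m a -> exists c, m (1 - c * a)].

Definition rad (a : R) : Prop := forall m, maximal_ideal m -> m a.

Lemma rad_submodule : submodule (rad : (R^o : lmodType R) -> Prop).
Proof.
split=> [m [hm _ _]|a x y Jx Jy m mm]; first exact: hm.1.
by have [hm _ _] := mm; apply: hm.2; [exact: Jx|exact: Jy].
Qed.

Lemma radMl a b : rad b -> rad (a * b).
Proof. exact: (submodZ rad_submodule a). Qed.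

Lemma radMr a b : rad a -> rad (a * b).
Proof.
move=> Ja m mm; have [hm m1 mmax] := mm.
have [mb|nmb] := pselect (m b); first exact: (submodZ hm a mb).
apply: (Ja (fun x => m (x * b))); split.
- split; first by rewrite mul0r; exact: hm.1.
  move=> r x y mx my; rewrite mulrDl -[r *: x]/(r * x) -mulrA.
  exact: (hm.2 r (x * b) (y * b)).
- by rewrite mul1r.
- move=> x nmx; have [c mc] := mmax _ nmx; exists (b * c).
  have := submodZ hm b mc; congr (m _).
  by rewrite -[LHS]/(b * _) mulrBr mulrBl mulr1 mul1r !mulrA.
Qed.

(* Semisimplicity of R/rad: the left ideal I has a complement modulo rad. *)
Lemma rad_complement (I : R -> Prop) : finlen (R^o : lmodType R) ->
  submodule (I : (R^o : lmodType R) -> Prop) ->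
  exists e : R, I e /\ forall a, I a -> rad (a - a * e).
Proof.
move=> [n [rho [b s]]] hI.
pose P I' := submodule (I' : (R^o : lmodType R) -> Prop) /\
  exists e e' : R, [/\ I e, I' e' & 1 = e + e'].
pose Q k := `[< exists2 I', P I' & rho I' = k >].
have exQ : exists k, Q k.
  exists (rho (fun=> True)); apply/asboolP; exists (fun=> True) => //.
  by split; [|exists 0, 1; rewrite add0r; split=> //; exact: hI.1].
case: (ex_minnP exQ) => k /asboolP [I' [hI' [e [e' [Ie Ie' ee']]]] I'k] kmin.
suff cap z : I z -> I' z -> rad z.
  exists e; split=> // a Ia; apply: cap.
    exact (submodB hI Ia (submodZ hI a Ie)).
  suff -> : a - a * e = a * e' by exact (submodZ hI' a Ie').
  by rewrite -{1}[a]mulr1 -mulrBr ee' addrC addKr.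
move=> Iz I'z m mm; apply: contrapT => nmz; have [hm _ mmax] := mm.
have [c mc] := mmax _ nmz.
have hI'' := submodule_cap hI' hm.
have [_ eq] := s _ _ hI'' hI' (fun x h => h.1).
suff /eq/(_ z I'z) [_] : (rho I' <= rho (fun x => I' x /\ m x))%N by [].
rewrite I'k; apply: kmin; apply/asboolP; exists (fun x => I' x /\ m x) => //.
split=> //; exists (e + e' * c * z), (e' - e' * c * z); split.
- exact (submodD hI Ie (submodZ hI (e' * c) Iz)).
- split; first exact (submodB hI' Ie' (submodZ hI' (e' * c) I'z)).
  have := submodZ hm e' mc; congr (m _).
  by rewrite -[LHS]/(e' * _) mulrBr mulr1 mulrA.
- by rewrite addrACA subrr addr0.
Qed.

Definition radmul (M : lmodType R) (S : M -> Prop) (y : M) : Prop :=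
  forall U : M -> Prop, submodule U ->
    (forall j x, rad j -> S x -> U (j *: x)) -> U y.

Lemma submodule_radmul (M : lmodType R) (S : M -> Prop) : submodule (radmul S).
Proof.
split=> [U hU _|a x y Sx Sy U hU US]; first exact: hU.1.
by apply: hU.2; [exact: Sx|exact: Sy].
Qed.

Lemma radmulI (M : lmodType R) (S : M -> Prop) j x : rad j -> S x ->
  radmul S (j *: x).
Proof. by move=> Jj Sx U hU; apply. Qed.

Lemma radmul_mono (M : lmodType R) (S S' : M -> Prop) :
  (forall x, S x -> S' x) -> forall x, radmul S x -> radmul S' x.
Proof.
by move=> SS' x Sx U hU US'; apply: Sx => // j y Jj /SS'; exact: US'.
Qed.

Definition radpow (M : lmodType R) k : M -> Prop :=
  iter k (@radmul M) (fun=> True).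

Lemma submodule_radpow (M : lmodType R) k : submodule (@radpow M k).
Proof. by case: k => [|k]; [|exact: submodule_radmul]. Qed.

Lemma radpow_decr (M : lmodType R) k x : @radpow M k.+1 x -> @radpow M k x.
Proof.
by elim: k x => //= k IH x; apply: radmul_mono => y; exact: IH.
Qed.

Lemma radpow_regular : finlen (R^o : lmodType R) ->
  exists k, forall x : (R^o : lmodType R), radpow k x -> x = 0.
Proof.
move=> len; have [n rn] := len.
have [|k kP] := ranked_descending rn (fun k => submodule_radpow _ k).
  by move=> k x; exact: radpow_decr.
exists k => x kx; apply: contrapT => x0.
have [|U [hU UN [y Ny nUy] Umax]] := maximal_submodule len (submodule_radpow _ k).
  by exists x.
apply: nUy; apply: (kP y Ny) => // j z Jj Nz.
have [Uz|nUz] := pselect (U z); first exact: submodZ.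
apply: (Jj (fun a : R => U (a *: z))); split.
- exact: (submodule_preim (lelt z) hU).
- by rewrite scale1r.
- move=> a nUa; have [|u [c [Uu e]]] := Umax _ _ nUa z Nz.
    exact (submodZ (submodule_radpow _ k) a Nz).
  exists c; have -> : (1 - c * a) *: z = u; last by [].
  by rewrite scalerBl scale1r -scalerA {1}e addrK.
Qed.

Lemma radpow_module (M : lmodType R) k x : radpow k x ->
  forall U : M -> Prop, submodule U ->
  (forall (a : (R^o : lmodType R)) y, radpow k a -> U ((a : R) *: y)) -> U x.
Proof.
elim: k x => [|k IH] x; first by move=> _ U hU /(_ 1 x I); rewrite scale1r.
move=> /= Jx U hU UP; apply: Jx => // j y Jj ky.
apply: (IH y ky (fun y => forall j, rad j -> U (j *: y)) _ _ j Jj).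
  split=> [i Ji|a u v Uu Uv i Ji]; first by rewrite scaler0; exact: hU.1.
  rewrite scalerDr scalerA; apply: submodD => //; last exact: Uv.
  by apply: Uu; exact: radMr.
move=> a z ka i Ji; rewrite scalerA.
by apply: (UP (i * a)); exact: (radmulI (M := R^o) Ji ka).
Qed.

Lemma radpow_zero : finlen (R^o : lmodType R) ->
  exists k, forall (M : lmodType R) (x : M), radpow k x -> x = 0.
Proof.
move=> /radpow_regular [k kP]; exists k => M x kx.
apply: (radpow_module kx (submodule_zero M)) => a y /kP ->.
exact: scale0r.
Qed.

Definition radsub (M : lmodType R) : M -> Prop := radmul (fun=> True).

(* A retraction modulo the radical is obtained from semisimplicity of R/rad and
   lifted along the projective module F0; it is a retraction up to an
   automorphism of F1 because the radical is nilpotent. *)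
Lemma split_mod_rad (F1 F0 : lmodType R) (i : {linear F1 -> F0}) :
  finlen (R^o : lmodType R) -> projective F0 ->
  (forall x, radsub (i x) -> radsub x) ->
  exists g : {linear F0 -> F1}, cancel i g.
Proof.
move=> len prF0 iJ.
pose hJ1 := submodule_radmul (M := F1) (fun=> True).
pose hJ0 := submodule_radmul (M := F0) (fun=> True).
pose W : lmodType R := quom hJ1; pose pr : {linear F1 -> W} := toquo hJ1.
pose G0 (z : (F0 * W)%type) := exists x y, [/\ radsub y, z.1 = i x + y & z.2 = pr x].
have pG0 : pgraph G0.
  split; first split.
  - by exists 0, 0; split; rewrite ?linear0 ?addr0 //; exact: hJ0.1.
  - move=> a z z' [x [y [Jy z1 z2]]] [x' [y' [Jy' z1' z2']]].
    exists (a *: x + x'), (a *: y + y'); split; first exact: hJ0.2.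
      by rewrite /= z1 z1' linearP scalerDr addrACA.
    by rewrite [RHS]linearP -z2 -z2'.
  - move=> w [x [y [Jy /= e ->]]]; apply/toquo_ker; apply: iJ.
    have -> : i x = - y by apply/eqP; rewrite -addr_eq0 -e.
    exact: (submodN hJ0 Jy).
have [|f fP] := linear_extension pG0.
  move=> G pG G0G v; have [hG _] := pG.
  pose I (a : (R^o : lmodType R)) := exists w, G ((a : R) *: v, w).
  have hI : submodule I.
    split; first by exists 0; rewrite scale0r; exact: hG.1.
    move=> a x y [w Gw] [w' Gw']; exists (a *: w + w').
    have := hG.2 a _ _ Gw Gw'; congr (G (_, _)).
    by rewrite /= scalerDl scalerA.
  have [e [[w Gw] eP]] := rad_complement len hI.
  exists w => a w' Gw'; apply: (pgraph_fun pG Gw').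
  have GJ : G ((a - a * e) *: v, 0).
    apply: G0G; exists 0, ((a - a * e) *: v); split.
    - by apply: radmulI => //; apply: eP; exists w'.
    - by rewrite linear0 add0r.
    - by rewrite linear0.
  have := hG.2 a _ _ Gw GJ; congr (G (_, _)); last by rewrite /= addr0.
  by rewrite /= scalerBl -scalerA addrCA subrr addr0.
have [r rE] := prF0 _ _ pr f (@toquo_surj _ _ _ hJ1).
pose h := lsub (lid F1) (lcomp r i).
have hJ x : radsub (h x).
  apply/(toquo_ker hJ1); rewrite linearB; apply/eqP; rewrite subr_eq0; apply/eqP.
  rewrite [RHS]rE; apply/esym/fP; exists x, 0; split=> //; first exact: hJ0.1.
  by rewrite addr0.
have hpow k x : radpow k x -> radpow k.+1 (h x).
  elim: k x => [|k IH] x; first by move=> _; exact: hJ.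
  move=> /= kx; apply: (kx (fun y => radmul (radpow k.+1) (h y))).
    exact: submodule_preim (submodule_radmul _).
  by move=> j y Jj ky; rewrite linearZ /=; apply: radmulI => //; exact: IH.
have [N NP] := radpow_zero len.
have hN x : iter N h x = 0.
  by apply: NP; elim: N => //= N; exact: hpow.
have hE x : x - r (i x) = h x by [].
have ri_inj : injective (lcomp r i).
  apply: injective_ker0 => x /= rx; have hx : h x = x by rewrite -hE rx subr0.
  by rewrite -(hN x); elim: N {NP hN} => //= N <-.
have ri_surj : surj (lcomp r i).
  move=> y; suff [x xE] : exists x, r (i x) = y - iter N h y.
    by exists x; rewrite /= xE hN subr0.
  elim: N {NP hN} => [|N [x xE]]; first by exists 0; rewrite !linear0 subrr.
  exists (x + iter N h y); have -> : iter N.+1 h y = iter N h y - r (i (iter N h y)) by [].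
  by rewrite (linearD i) (linearD r) xE opprB [RHS]addrA addrAC.
have [g [gK _]] := inverse_map ri_inj ri_surj.
by exists (lcomp g r); exact: gK.
Qed.

End Radical.

(** * The finitistic dimension *)

Section TopStep.
Variables (K : fieldType) (R R' : nzRingType).
Variables (o : antipair K R R') (o' : antipair K R' R).
Hypotheses (oo' : compatible o o') (o'o : compatible o' o).
Hypothesis R'len : finlen (R'^o : lmodType R').
Variables (C : nat -> lmodType R) (d : forall i, {linear C i.+1 -> C i}).
Hypotheses (exd : forall i, exact_at (d i.+1) (d i)).
Hypotheses (prC : forall i, projective (C i)).

Lemma ext0_filtration j (M : lmodType R') :
  (forall S : fgmod R', simple S -> ext0 o d j S) -> finlen M -> ext0 o d j M.
Proof.
move=> simp [n rn]; elim/ltn_ind: n M rn => n IH M rn.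
have [M0|nM0] := pselect (zero_module M).
  move=> b hb _; exists (fun _ _ => 0); first exact: balanced0.
  by move=> m x; rewrite (M0 m) (balanced_zerol _ hb).
have lenM : finlen M by exists n.
have [|U [hU _ [z _ nUz] Umax]] := maximal_submodule lenM (@submodule_all _ M).
  apply: contrapT => no; apply: nM0 => x; apply: contrapT => x0; apply: no.
  by exists x.
pose p := toquo hU.
have ps : surj p by exact: toquo_surj.
have pker x : p x = 0 <-> U x by exact: toquo_ker.
have lenQ : finlen (quom hU) by exact: finlen_quo ps lenM.
have ex : exact_at (submval hU) p.
  move=> y; rewrite pker; split=> [Uy|[x <-]]; last exact: (subm_prop x).
  by exists (mksubm hU Uy).
have [|m mn rm] := ranked_proper (@submval_inj _ _ _ hU) _ rn.
  by move=> /(_ z) [x xz]; apply: nUz; rewrite -xz; exact: (subm_prop x).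
apply: (ext0_extension exd prC (@submval_inj _ _ _ hU) ps ex (IH m mn _ rm)).
apply: (simp (mkfg lenQ)); split=> [Q0|S hS]; first by apply/nUz/pker/Q0.
have [[x Sx nUx]|no] := pselect (exists2 x, S (p x) & ~ U x); [right|left] => y.
  have [y' <-] := ps y; have [u [c [Uu ->]]] := Umax x I nUx y' I.
  rewrite linearD linearZ; move/pker: Uu => ->; rewrite add0r.
  exact: (submodZ hS).
have [y' <-] := ps y => Sy; apply/pker; apply: contrapT => nUy.
by apply: no; exists y'.
Qed.

Lemma ext0_pure t : zero_module (C t.+2) ->
  (forall M : lmodType R', finlen M -> ext0 o d t M) ->
  forall x : C t.+1, radsub (d t x) -> radsub x.
Proof.
move=> C0 ext x Jdx; apply: contrapT => nJx.
have hJ := submodule_radmul (M := C t.+1) (fun=> True).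
pose ks := @kscale _ _ _ o' (C t.+1).
have [|||l [ll lE]] := @functional_extension K (C t.+1) ks (@kscaleA _ _ _ o' _)
  (@kscale1 _ _ _ o' _) (@kscaleDr _ _ _ o' _) (@kscaleDl _ _ _ o' _)
  (fun y a => exists2 z, radsub z & y = ks a x + z).
- by exists 0; [exact: hJ.1|rewrite /ks /kscale rmorph0 scale0r addr0].
- move=> k _ _ a b [z Jz ->] [z' Jz' ->]; exists (ks k z + z').
    by apply: (submodD hJ) => //; exact: (submodZ hJ).
  by rewrite /ks kscaleDr kscaleA kscaleDl addrACA.
- move=> a [z Jz e]; apply/eqP; apply: contrapT => /negP an0; apply: nJx.
  have e1 : ks a x = - z by apply/eqP; rewrite -addr_eq0 -e.
  rewrite -(kscale1 o' x) -(mulVf an0) -kscaleA -/ks e1.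
  by apply: (submodZ hJ); exact: (submodN hJ).
have lJ y : radsub y -> l y = 0.
  by move=> Jy; apply: lE; exists y => //; rewrite /ks /kscale rmorph0 scale0r add0r.
have lx : l x = 1.
  by apply: lE; exists 0; [exact: hJ.1|rewrite /ks kscale1 addr0].
have [ks1 os1] := oo'; have [ks2 os2] := o'o.
pose Ro' : lmodType R' := R'^o.
have hJ' : submodule (fun a : Ro' => rad (o' a)).
  split; first by rewrite (_ : o' 0 = 0); [exact: (rad_submodule R).1|];
     apply: (addIr (o' 0)); rewrite -antiD !add0r.
  move=> a u v Ju Jv; rewrite antiD antiM.
  by apply: (submodD (rad_submodule R)) => //; exact: radMr.
pose b0 (a : Ro') (y : C t.+1) := l (o' a *: y).
have hb0 : balanced o b0.
  split=> [y k a a'|a y z|r a y].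
  - rewrite /b0 antiD antiM ks2 -scal_comm scalerDl -scalerA; exact: ll.
  - by rewrite /b0 scalerDr (kfunctionalD ll).
  - by rewrite /b0 antiM os2 scalerA.
have [|b hb bE] := balanced_descend (@toquo_surj _ _ _ hJ') hb0.
  by move=> a y /toquo_ker Ja; apply: lJ; exact: radmulI.
have [||c hc cE] := ext (quom hJ') _ b hb.
- by apply: finlen_quo R'len; exact: (@toquo_surj _ _ _ hJ').
- by move=> m y; rewrite (C0 y) linear0 (balanced_zeror _ hb).
pose one : quom hJ' := toquo hJ' (1 : Ro').
have : b one x = 1 by rewrite bE /b0 anti1 scale1r.
rewrite cE; suff -> : c one (d t x) = 0 by move/eqP; rewrite eq_sym oner_eq0.
have [_ cD ca] := hc.
have := Jdx (fun y => forall q, c q y = 0); apply.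
  split=> [q|a u v cu cv q]; first exact: balanced_zeror hc.
  by rewrite cD cv -ca cu addr0.
move=> j y Jj _ q; rewrite -ca; have [a <-] := @toquo_surj _ _ _ hJ' q.
rewrite -linearZ; have -> : toquo hJ' (o j *: a) = 0.
  by apply/toquo_ker; rewrite antiM os2; exact: radMl.
exact: balanced_zerol hc.
Qed.

End TopStep.

Section Findim.
Variables (K : fieldType) (R R' : nzRingType).
Variables (o : antipair K R R') (o' : antipair K R' R).
Hypotheses (oo' : compatible o o') (o'o : compatible o' o).
Hypotheses (Rlen : finlen (R^o : lmodType R)) (R'len : finlen (R'^o : lmodType R')).

Lemma pd_le (X : lmodType R) m : pd X <> Infty ->
  (forall t (C : nat -> lmodType R) (d : forall i, {linear C i.+1 -> C i}),
     (m <= t)%N -> (forall i, exact_at (d i.+1) (d i)) ->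
     (forall i, projective (C i)) ->
     (forall i, (t.+1 < i)%N -> zero_module (C i)) ->
     forall S : fgmod R', simple S -> ext0 o d t S) ->
  ele (pd X) (Fin m).
Proof.
case pdX : (pd X) => [n|//] _ ext /=; rewrite leqNgt; apply/negP => mn.
have [C [[e [d res]] prC]] := ninf_fin pdX.
have [es ed exd C0] := res.
have prC' i : projective (C i).
  by have [/prC|/C0/projective_zero] := leqP i n.
case: n mn pdX res prC C0 => // t mt pdX res _ C0.
have ext' (M : lmodType R') : finlen M -> ext0 o d t M.
  by apply: ext0_filtration => //; exact: ext.
have pure := ext0_pure oo' o'o R'len (C0 t.+2 (leqnn _)) ext'.
have [g gK] := split_mod_rad Rlen (prC' t) pure.
have [C' [resC' prC'']] := resolution_shorten res prC' gK.
have : ele (pd X) (Fin t) by apply/ninf_leP; exists t => //; exists C'.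
by rewrite pdX /= ltnn.
Qed.

Lemma big_findim_le (f : fgmod R' -> enat) :
  (forall (C : nat -> lmodType R) (d : forall i, {linear C i.+1 -> C i}) top m
      (M : fgmod R'), (forall i, exact_at (d i.+1) (d i)) ->
    (forall i, projective (C i)) -> (forall i, (top < i)%N -> zero_module (C i)) ->
    ele (f M) (Fin m) -> (m < top)%N -> ext0 o d top.-1 M) ->
  ele (big_findim R) (sup_simple f).
Proof.
move=> H; apply/esup_leP => _ [X [pdX ->]].
case e : (sup_simple f) => [m|]; last by case: (pd X).
apply: pd_le => // t C d mt exd prC C0 S sS.
apply: (H C d t.+1 m S exd prC C0) => //; rewrite -e.
by apply: (esupP _).1; exists S.
Qed.

Lemma findim_le_sub_ddell : ele (big_findim R) (sup_simple (@sub_ddell R')).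
Proof.
apply: big_findim_le => C d top m M exd prC C0 fM mt.
exact: (ext0_sub_ddell oo' o'o exd prC R'len C0 fM mt).
Qed.

Lemma findim_le_ddell : ele (big_findim R) (sup_simple (@ddell R')).
Proof.
apply: big_findim_le => C d top m M exd prC C0 fM mt.
exact: (ext0_ddell oo' o'o exd prC R'len C0 fM mt).
Qed.

End Findim.

Section DellBounds.
Variable R : nzRingType.

Lemma sub_ddell_le_dell (M : fgmod R) : ele (sub_ddell M) (dell M).
Proof.
by apply: (einfP _).1; exists M; split=> //; exists (lid M).
Qed.

Lemma ddell_le_dell (M : fgmod R) : ele (ddell M) (dell M).
Proof.
case e : (dell M) => [m|]; last by case: (ddell M).
apply/ninf_leP; exists m => //; exists 0%N.
exists (fun i => if i is 0 then M else fgzero R); split=> //.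
  exists (lid M), (fun i => lzero _ _); split=> [x|x|i x|[//|i _]]; last exact: zmod_zero.
  - by exists x.
  - by split=> [x0|[y <-]] //; exists 0; exact: esym x0.
  - by split=> [_|[y <-]] //; exists 0; rewrite (zmod_zero x).
by case=> // _; rewrite subn0 -/(dell M) e; exact: ele_refl.
Qed.

Lemma sup_simple_le (f : fgmod R -> enat) z :
  (forall S : fgmod R, simple S -> ele (f S) z) -> ele (sup_simple f) z.
Proof. by move=> fz; apply/esup_leP => _ [S [sS ->]]; exact: fz. Qed.

Lemma sup_simple_ge (f : fgmod R -> enat) (S : fgmod R) : simple S -> ele (f S) (sup_simple f).
Proof. by move=> sS; apply: (esupP _).1; exists S. Qed.

End DellBounds.

(** * Finite dimensional algebras *)

Section Algebra.
Variables (K : fieldType) (A : falgType K).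

Definition ksubspace (S : A -> Prop) := S 0 /\ forall k x y, S x -> S y -> S (k *: x + y).

Lemma dim_rank : exists rho : (A -> Prop) -> nat,
  (forall S, (rho S <= \dim {:A})%N) /\
  (forall S S', ksubspace S -> ksubspace S' -> (forall x, S x -> S' x) ->
     (rho S <= rho S')%N /\ ((rho S' <= rho S)%N -> forall x, S' x -> S x)).
Proof.
pose inS (S : A -> Prop) (U : {vspace A}) := forall u, u \in U -> S u.
pose Q S k := `[< k = 0%N \/ exists2 U, inS S U & \dim U = k >].
have exQ S : exists k, Q S k by exists 0%N; apply/asboolP; left.
have bQ S k : Q S k -> (k <= \dim {:A})%N.
  by move=> /asboolP [->//|[U _ <-]]; exact/dimvS/subvf.
pose rho S := ex_maxn (exQ S) (bQ S).
have rhoP S : ksubspace S -> exists2 U, inS S U & \dim U = rho S.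
  move=> hS; rewrite /rho; case: ex_maxnP => k /asboolP [->|//] _.
  by exists 0%VS; rewrite ?dimv0 // => u; rewrite memv0 => /eqP ->; exact: hS.1.
have rho_max S U : inS S U -> (\dim U <= rho S)%N.
  move=> SU; rewrite /rho; case: ex_maxnP => k _; apply; apply/asboolP.
  by right; exists U.
exists rho; split=> [S|S S' hS hS' SS'].
  by rewrite /rho; case: ex_maxnP => k /bQ.
have [U SU dU] := rhoP S hS; have S'U : inS S' U by move=> u /SU/SS'.
split; first by rewrite -dU; exact: rho_max.
move=> le x S'x; suff xU : x \in U by exact: SU.
have inUx : inS S' (U + <[x]>)%VS.
  move=> _ /memv_addP [u uU [_ /vlineP [k ->] ->]]; rewrite addrC.
  by apply: hS'.2 => //; exact: S'U.
have := rho_max _ _ inUx => /leq_trans/(_ le); rewrite -dU => dle.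
have /eqP -> : U == (U + <[x]>)%VS by rewrite eqEdim addvSl.
by apply: (subvP (addvSr U <[x]>)); exact: memv_line.
Qed.

Lemma finlen_left : finlen (A^o : lmodType A).
Proof.
have [rho [b s]] := dim_rank; exists (\dim {:A}), rho; split=> [S _|S S' hS hS'].
  exact: b.
have ks (T : A^o -> Prop) : submodule T -> ksubspace T.
  by move=> [T0 TP]; split=> // k x y Tx Ty; rewrite -mulr_algl; exact: (TP k%:A x y).
by apply: s; exact: ks.
Qed.

Lemma finlen_right : finlen ((A^c)^o : lmodType A^c).
Proof.
have [rho [b s]] := dim_rank; exists (\dim {:A}), rho; split=> [S _|S S' hS hS'].
  exact: b.
have ks (T : (A^c)^o -> Prop) : submodule T -> ksubspace T.
  by move=> [T0 TP]; split=> // k x y Tx Ty; rewrite -mulr_algr; exact: (TP k%:A x y).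
by apply: s; exact: ks.
Qed.

Definition scal_op (k : K) : A^c := k%:A.

Lemma scal_op_additive : {morph scal_op : x y / x - y}.
Proof. by move=> x y; exact: scalerBl. Qed.

Lemma scal_op_multiplicative : monoid_morphism scal_op.
Proof.
split=> [|x y]; first exact: scale1r.
by change ((x * y)%:A = y%:A * x%:A :> A); rewrite mulr_algl scalerA mulrC.
Qed.

HB.instance Definition _ := GRing.isZmodMorphism.Build K A^c scal_op scal_op_additive.
HB.instance Definition _ := GRing.isMonoidMorphism.Build K A^c scal_op scal_op_multiplicative.

Definition left_right : antipair K A A^c :=
  @Antipair K A A^c (fun a => a) scal_op (fun _ _ => erefl) (fun _ _ => erefl) erefl
    (fun k (x : A) => etrans (mulr_algr k x) (esym (mulr_algl k x))).

Definition right_left : antipair K A^c A :=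
  @Antipair K A^c A (fun a => a) (in_alg A) (fun _ _ => erefl) (fun _ _ => erefl) erefl
    (fun k (x : A) => etrans (mulr_algl k x) (esym (mulr_algr k x))).

Lemma compatible_left_right : compatible left_right right_left.
Proof. by []. Qed.

Lemma compatible_right_left : compatible right_left left_right.
Proof. by []. Qed.

End Algebra.

Theorem theorem1p2 (K : fieldType) (A : falgType K)
    (finT : finite_up_to_iso (@T_alg K A)) :
  [/\ ([/\ Findim_op A <= sub_ddell_alg A,
           sub_ddell_alg A <= dell_alg A,
           dell_alg A <= phiTdim A
         & phiTdim A <= phidim A])%enat,
      ([/\ Findim_op A <= ddell_alg A,
           ddell_alg A <= dell_alg A,
           dell_alg A <= phiTdim A
         & phiTdim A <= phidim A])%enat,
      phiTdim A <> Infty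
    & findim_op A <> Infty].
Proof.
have lenA := finlen_left A; have lenAc := finlen_right A.
have lr := compatible_left_right A; have rl := compatible_right_left A.
have h1 : ele (Findim_op A) (sub_ddell_alg A).
  exact: (findim_le_sub_ddell lr rl lenA lenAc).
have h1' : ele (Findim_op A) (ddell_alg A).
  exact: (findim_le_ddell lr rl lenA lenAc).
have h2 : ele (sub_ddell_alg A) (dell_alg A).
  apply: sup_simple_le => S sS; apply: ele_trans (sub_ddell_le_dell S) _.
  exact: sup_simple_ge.
have h2' : ele (ddell_alg A) (dell_alg A).
  apply: sup_simple_le => S sS; apply: ele_trans (ddell_le_dell S) _.
  exact: sup_simple_ge.
have h3 : ele (dell_alg A) (phiTdim A).
  by apply: sup_simple_le => S sS; exact: dell_le_phi_set.
have h4 : ele (phiTdim A) (phidim A) by exact: phi_set_le.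
have fin : phiTdim A <> Infty.
  exact: (phi_set_finite lenAc (@simple_syzygy_summand_indecomposable _) finT).
split=> // e; have h5 : ele (findim_op A) (Findim_op A).
  apply/esup_leP => _ [X [_ pdX ->]]; apply: (esupP _).1; by exists X.
have := ele_trans h5 (ele_trans h1 (ele_trans h2 h3)).
by rewrite e; case: (phiTdim A) fin.
Qed.
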